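(* Let $f:\mathbb{C}^\dagger\to\mathbb{D}^\dagger$ be a marked 2-functor. Then $f$ is marked cofinal if and only if the following conditions hold: (1) for every object $d\in\mathbb{D}$, there exists a morphism $g_d:d\to f(c)$ (for some $c\in\mathbb{C}$) which is initial in both $\mathrm{ho}(\mathbb{C}^\dagger_{d\uparrow})[\mathcal{W}^{-1}]$ and $\mathrm{ho}(\mathbb{D}^\dagger_{d\uparrow})[\mathcal{W}^{-1}]$; (2) every marked morphism $d\to f(c)$ of $\mathbb{D}^\dagger$ (with $d\in\mathbb{D}$, $c\in\mathbb{C}$) is initial in $\mathrm{ho}(\mathbb{C}^\dagger_{d\uparrow})[\mathcal{W}^{-1}]$; (3) for any marked morphism $w:b\to d$ in $\mathbb{D}$, the functor $w^*:\mathrm{ho}(\mathbb{C}^\dagger_{d\uparrow})[\mathcal{W}^{-1}]\to\mathrm{ho}(\mathbb{C}^\dagger_{b\uparrow})[\mathcal{W}^{-1}]$ induced by precomposition with $w$ preserves initial objects.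
   Context: 2-categories and 2-functors are strict. A marked 2-category $\mathbb{C}^\dagger=(\mathbb{C},W_{\mathbb{C}})$ is a 2-category with a set of 1-morphisms (''marked'') containing all identities; a marked 2-functor is a strict 2-functor preserving marked morphisms. $\mathbb{C}^{(\mathrm{op},-)}$ is the 1-morphism dual. For a 2-category $\mathbb{A}$, $\mathrm{ho}(\mathbb{A})$ is the 1-category with the same objects and $\mathrm{Hom}(a,a')=\pi_0\mathbb{A}(a,a')$; a marking on $\mathbb{A}$ induces one on $\mathrm{ho}(\mathbb{A})$, and $[\mathcal{W}^{-1}]$ denotes the 1-categorical localization at marked morphisms. Oplax slices: for $d\in\mathbb{D}$, $\mathbb{C}^\dagger_{d\uparrow}$ (relative to $f$) has objects pairs $(c,\,h:d\to f(c))$ with $c\in\mathbb{C}$; 1-morphisms $(c,h)\to(c',k)$ are pairs $(u:c\to c',\ \beta:f(u)\circ h\Rightarrow k)$; 2-morphisms $(u,\beta)\Rightarrow(v,\alpha)$ are $\nu:u\Rightarrow v$ in $\mathbb{C}$ with $\alpha\circ(f(\nu)*h)=\beta$. $(u,\beta)$ is marked iff $u$ is marked in $\mathbb{C}^\dagger$ and $\beta$ is invertible. $\mathbb{D}^\dagger_{d\uparrow}$ (and, for $c\in\mathbb{C}$, $\mathbb{C}^\dagger_{c\uparrow}$) denotes the same construction for the identity functor; a morphism $d\to f(c)$ is an object of both $\mathbb{C}_{d\uparrow}$ and $\mathbb{D}_{d\uparrow}$. Marked cocones: for a marked 2-category $\mathbb{B}^\dagger$ let $\hat{\mathfrak{C}}^\dagger_{\mathbb{B}\uparrow}:\mathbb{B}^{(\mathrm{op},-)}\to\mathrm{Cat}$,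 $b\mapsto\mathrm{ho}(\mathbb{B}^\dagger_{b\uparrow})[\mathcal{W}^{-1}]$, functorial by precomposition. For a 2-functor $F:\mathbb{B}\to\mathbb{A}$ let $N^\dagger_F:\mathbb{A}\to\mathrm{Cat}$, $a\mapsto\mathrm{Nat}(\hat{\mathfrak{C}}^\dagger_{\mathbb{B}\uparrow},\mathbb{A}(F(-),a))$, the category of 2-natural transformations and modifications. Explicitly, an object of $N_F^\dagger(a)$ consists of 1-morphisms $\alpha_b:F(b)\to a$ for $b\in\mathbb{B}$ and 2-morphisms $\alpha_u:\alpha_b\Rightarrow\alpha_{b'}\circ F(u)$ for $u:b\to b'$ such that $\alpha_u$ is invertible for $u$ marked; $\alpha_{\mathrm{id}}=\mathrm{id}$ and $\alpha_{vu}=(\alpha_v*F(u))\circ\alpha_u$; and for $\beta:u\Rightarrow w$, $(\alpha_{b'}*F(\beta))\circ\alpha_u=\alpha_w$. A morphism $\alpha\to\beta$ is a family $\epsilon_b:\alpha_b\Rightarrow\beta_b$ with $\beta_u\circ\epsilon_b=(\epsilon_{b'}*F(u))\circ\alpha_u$ for all $u:b\to b'$. Marked cofinality: $f:\mathbb{C}^\dagger\to\mathbb{D}^\dagger$ is marked cofinal if for every 2-category $\mathbb{A}$ and every 2-functor $F:\mathbb{D}\to\mathbb{A}$, the canonical restriction map $N_F^\dagger\Rightarrow N^\dagger_{f^*F}$, $(\alpha_d)_{d\in\mathbb{D}}\mapsto(\alpha_{f(c)})_{c\in\mathbb{C}}$, where $f^*F=F\circ f$, is a levelwise equivalence of categories.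 *)

(* Defs.v *)
From Stdlib Require Import ssreflect Relations ProofIrrelevance.
From Stdlib Require Import FunctionalExtensionality PropExtensionality IndefiniteDescription.

Set Implicit Arguments.
Unset Strict Implicit.
Unset Printing Implicit Defensive.

Declare Scope twocat_scope.
Open Scope twocat_scope.

Record Category := {
  Ob :> Type;
  Hom : Ob -> Ob -> Type;
  idm : forall x, Hom x x;
  cmp : forall x y z, Hom y z -> Hom x y -> Hom x z;
  cmp_idl : forall x y (f : Hom x y), cmp (idm y) f = f;
  cmp_idr : forall x y (f : Hom x y), cmp f (idm x) = f;
  cmp_assoc : forall x y z t (h : Hom z t) (g : Hom y z) (f : Hom x y),
    cmp h (cmp g f) = cmp (cmp h g) f
}.
Arguments Hom {c} _ _ : rename.
Arguments idm {c} _ : rename.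
Arguments cmp {c x y z} _ _ : rename.

Notation "x ⇒ y" := (Hom x y) (at level 70, no associativity) : twocat_scope.
Notation "g • f" := (cmp g f) (at level 40, left associativity) : twocat_scope.

Definition is_iso (K : Category) (x y : K) (f : x ⇒ y) : Prop :=
  exists g : y ⇒ x, g • f = idm x /\ f • g = idm y.

Definition Initial (K : Category) (i : K) : Prop :=
  forall x : K, exists m : i ⇒ x, forall m' : i ⇒ x, m' = m.

Record Functor (K L : Category) := {
  fun_ob :> K -> L;
  fun_map : forall x y : K, x ⇒ y -> fun_ob x ⇒ fun_ob y;
  fun_map_id : forall x : K, fun_map (idm x) = idm (fun_ob x);
  fun_map_cmp : forall (x y z : K) (g : y ⇒ z) (f : x ⇒ y),
    fun_map (g • f) = fun_map g • fun_map f
}.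

Definition PreservesInitial (K L : Category) (F : Functor K L) : Prop :=
  forall i : K, Initial i -> Initial (F i).

Definition idF (K : Category) : Functor K K :=
  {| fun_ob := fun x => x; fun_map := fun x y f => f;
     fun_map_id := fun x => eq_refl; fun_map_cmp := fun x y z g f => eq_refl |}.

Program Definition compF (K L M : Category) (G : Functor L M) (F : Functor K L) :
  Functor K M := {| fun_ob := fun x => G (F x);
                    fun_map := fun x y f => fun_map G (fun_map F f) |}.
Next Obligation. by rewrite !fun_map_id. Qed.
Next Obligation. by rewrite !fun_map_cmp. Qed.

Definition NatIso (K L : Category) (F G : Functor K L) : Prop :=
  exists η : forall x : K, F x ⇒ G x,
    (forall x, is_iso (η x)) /\
    (forall (x y : K) (f : x ⇒ y), η y • fun_map F f = fun_map G f • η x).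

Definition IsEquivalence (K L : Category) (F : Functor K L) : Prop :=
  exists G : Functor L K, NatIso (compF G F) (idF K) /\ NatIso (compF F G) (idF L).

(** The quotient of [T] by the equivalence relation generated by [R], realized
    as the type of equivalence classes. *)
Definition Quot (T : Type) (R : T -> T -> Prop) : Type :=
  {P : T -> Prop | exists x, P = clos_refl_sym_trans T R x}.

Definition cls (T : Type) (R : T -> T -> Prop) (x : T) : Quot R :=
  exist _ (clos_refl_sym_trans T R x) (ex_intro _ x eq_refl).

Definition repr (T : Type) (R : T -> T -> Prop) (q : Quot R) : T :=
  proj1_sig (constructive_indefinite_description _ (proj2_sig q)).

Lemma cls_repr (T : Type) (R : T -> T -> Prop) (q : Quot R) : cls R (repr q) = q.
Proof.
rewrite /repr; case: (constructive_indefinite_description _ _) => x /= e.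
case: q e => P HP /= e; apply: subset_eq_compat; by rewrite e.
Qed.

Lemma cls_surj (T : Type) (R : T -> T -> Prop) (q : Quot R) : exists x, q = cls R x.
Proof. by exists (repr q); rewrite cls_repr. Qed.

Lemma cls_eq (T : Type) (R : T -> T -> Prop) (x y : T) :
  clos_refl_sym_trans T R x y -> cls R x = cls R y.
Proof.
move=> h; apply: subset_eq_compat; apply: functional_extensionality => z.
apply: propositional_extensionality; split=> h'.
- by apply: rst_trans h'; apply: rst_sym.
- by apply: rst_trans h'.
Qed.

Lemma cls_inj (T : Type) (R : T -> T -> Prop) (x y : T) :
  cls R x = cls R y -> clos_refl_sym_trans T R x y.
Proof. case=> e; rewrite e; exact: rst_refl. Qed.

Lemma repr_cls (T : Type) (R : T -> T -> Prop) (x : T) :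
  clos_refl_sym_trans T R (repr (cls R x)) x.
Proof. by apply: cls_inj; rewrite cls_repr. Qed.

Lemma clos_map (T U : Type) (R : T -> T -> Prop) (S : U -> U -> Prop) (f : T -> U) :
  (forall x y, R x y -> clos_refl_sym_trans U S (f x) (f y)) ->
  forall x y, clos_refl_sym_trans T R x y -> clos_refl_sym_trans U S (f x) (f y).
Proof.
move=> H x y; elim=> {x y} [x y /H //|x|x y _ IH|x y z _ h1 _ h2].
- exact: rst_refl.
- exact: rst_sym.
- exact: rst_trans h1 h2.
Qed.

(** The identity morphism [x ⇒ x], seen as a morphism [x ⇒ y] along an equality.
    It mediates between strictly equal but not convertible 1-cells. *)
Definition eqcell (K : Category) (x y : K) (p : x = y) : x ⇒ y :=
  match p in _ = z return x ⇒ z with eq_refl => idm x end.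

(** The last three axioms are the strict equalities of 2-cells [1 ⋆ α = α],
    [α ⋆ 1 = α] and [γ ⋆ (β ⋆ α) = (γ ⋆ β) ⋆ α], whose two sides only have the
    same type after transport along the equalities of 1-cells. *)
Record TwoCat := {
  ob :> Type;
  hom : ob -> ob -> Category;
  id1 : forall a, hom a a;
  comp1 : forall a b c, hom b c -> hom a b -> hom a c;
  hcomp : forall a b c (g g' : hom b c) (f f' : hom a b),
    g ⇒ g' -> f ⇒ f' -> comp1 g f ⇒ comp1 g' f';
  hcomp_id : forall a b c (g : hom b c) (f : hom a b),
    hcomp (idm g) (idm f) = idm (comp1 g f);
  interchange : forall a b c (g g' g'' : hom b c) (f f' f'' : hom a b)
    (β' : g' ⇒ g'') (β : g ⇒ g') (α' : f' ⇒ f'') (α : f ⇒ f'),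
    hcomp (β' • β) (α' • α) = hcomp β' α' • hcomp β α;
  comp1_idl : forall a b (f : hom a b), comp1 (id1 b) f = f;
  comp1_idr : forall a b (f : hom a b), comp1 f (id1 a) = f;
  comp1_assoc : forall a b c d (h : hom c d) (g : hom b c) (f : hom a b),
    comp1 h (comp1 g f) = comp1 (comp1 h g) f;
  hcomp_idl : forall a b (f f' : hom a b) (α : f ⇒ f'),
    eqcell (comp1_idl f') • hcomp (idm (id1 b)) α = α • eqcell (comp1_idl f);
  hcomp_idr : forall a b (f f' : hom a b) (α : f ⇒ f'),
    eqcell (comp1_idr f') • hcomp α (idm (id1 a)) = α • eqcell (comp1_idr f);
  hcomp_assoc : forall a b c d (h h' : hom c d) (g g' : hom b c) (f f' : hom a b)
    (γ : h ⇒ h') (β : g ⇒ g') (α : f ⇒ f'),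
    eqcell (comp1_assoc h' g' f') • hcomp γ (hcomp β α)
    = hcomp (hcomp γ β) α • eqcell (comp1_assoc h g f)
}.
Arguments hom {t} _ _ : rename.
Arguments id1 {t} _ : rename.
Arguments comp1 {t a b c} _ _ : rename.
Arguments hcomp {t a b c g g' f f'} _ _ : rename.

Notation "g ∘ f" := (comp1 g f) (at level 38, right associativity) : twocat_scope.
Notation "β ⋆ α" := (hcomp β α) (at level 38, right associativity) : twocat_scope.
Notation "g ◃ α" := (hcomp (idm g) α) (at level 38, right associativity) : twocat_scope.
Notation "β ▹ f" := (hcomp β (idm f)) (at level 38, right associativity) : twocat_scope.

Record TwoFunctor (C D : TwoCat) := {
  fob :> C -> D;
  fhom : forall a b : C, hom a b -> hom (fob a) (fob b);
  fcell : forall (a b : C) (u v : hom a b), u ⇒ v -> fhom u ⇒ fhom v;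
  fcell_id : forall (a b : C) (u : hom a b), fcell (idm u) = idm (fhom u);
  fcell_cmp : forall (a b : C) (u v w : hom a b) (β : v ⇒ w) (α : u ⇒ v),
    fcell (β • α) = fcell β • fcell α;
  fhom_id : forall a : C, fhom (id1 a) = id1 (fob a);
  fhom_comp : forall (a b c : C) (v : hom b c) (u : hom a b),
    fhom (v ∘ u) = fhom v ∘ fhom u;
  fcell_hcomp : forall (a b c : C) (v v' : hom b c) (u u' : hom a b)
    (β : v ⇒ v') (α : u ⇒ u'),
    eqcell (fhom_comp v' u') • fcell (β ⋆ α)
    = (fcell β ⋆ fcell α) • eqcell (fhom_comp v u)
}.

Section Eqcell.

Lemma eqcell_irr (K : Category) (x y : K) (p q : x = y) : eqcell p = eqcell q.
Proof. by rewrite (proof_irrelevance _ p q). Qed.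

Lemma eqcell_id (K : Category) (x : K) (p : x = x) : eqcell p = idm x.
Proof. exact: (eqcell_irr p eq_refl). Qed.

Lemma eqcell_cmp (K : Category) (x y z : K) (q : y = z) (p : x = y) :
  eqcell q • eqcell p = eqcell (eq_trans p q).
Proof. by case: _ / q; rewrite /= cmp_idl. Qed.

Lemma eqcell_iso (K : Category) (x y : K) (p : x = y) : is_iso (eqcell p).
Proof.
exists (eqcell (eq_sym p)); by case: _ / p; rewrite /= cmp_idl.
Qed.

Lemma is_iso_cmp (K : Category) (x y z : K) (g : y ⇒ z) (f : x ⇒ y) :
  is_iso g -> is_iso f -> is_iso (g • f).
Proof.
move=> [g' [g1 g2]] [f' [f1 f2]]; exists (f' • g'); split.
- by rewrite cmp_assoc -(cmp_assoc f') g1 cmp_idr.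
- by rewrite cmp_assoc -(cmp_assoc g) f2 cmp_idr.
Qed.

Lemma eqcell_whiskl (C : TwoCat) (a b c : C) (g : hom b c) (f f' : hom a b)
  (p : f = f') : g ◃ eqcell p = eqcell (f_equal (fun x => g ∘ x) p).
Proof. by case: _ / p; rewrite /= hcomp_id. Qed.

Lemma eqcell_whiskr (C : TwoCat) (a b c : C) (g g' : hom b c) (f : hom a b)
  (p : g = g') : eqcell p ▹ f = eqcell (f_equal (fun x => x ∘ f) p).
Proof. by case: _ / p; rewrite /= hcomp_id. Qed.

Lemma fcell_eqcell (C D : TwoCat) (F : TwoFunctor C D) (a b : C) (u v : hom a b)
  (p : u = v) : fcell F (eqcell p) = eqcell (f_equal (fun x => fhom F x) p).
Proof. by case: _ / p; rewrite /= fcell_id. Qed.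

Lemma eqcell_move (K : Category) (x x' y y' : K) (p : x = x') (q : y = y')
  (f : x ⇒ y) (f' : x' ⇒ y') :
  eqcell q • f = f' • eqcell p -> f = eqcell (eq_sym q) • f' • eqcell p.
Proof. by case: _ / q f' => f'; rewrite /= !cmp_idl. Qed.

Lemma whiskr_cmp (C : TwoCat) (a b c : C) (g g' g'' : hom b c) (f : hom a b)
  (β' : g' ⇒ g'') (β : g ⇒ g') : (β' • β) ▹ f = (β' ▹ f) • (β ▹ f).
Proof. by rewrite -interchange cmp_idl. Qed.

Lemma whiskl_cmp (C : TwoCat) (a b c : C) (g : hom b c) (f f' f'' : hom a b)
  (β' : f' ⇒ f'') (β : f ⇒ f') : g ◃ (β' • β) = (g ◃ β') • (g ◃ β).
Proof. by rewrite -interchange cmp_idl. Qed.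

Lemma whiskl_id1 (C : TwoCat) (a b : C) (w : hom b b) (e : w = id1 b)
  (g h : hom a b) (κ : g ⇒ h) (p : w ∘ g = g) (q : w ∘ h = h) :
  w ◃ κ = eqcell (eq_sym q) • κ • eqcell p.
Proof.
case: _ / (eq_sym e) p q => p q.
rewrite (eqcell_move (hcomp_idl κ)).
by congr (_ • _ • _); apply: eqcell_irr.
Qed.

Lemma whiskl_comp1 (C : TwoCat) (a b c c' : C) (v : hom c c') (u : hom b c)
  (w : hom b c') (e : w = v ∘ u) (g h : hom a b) (κ : g ⇒ h)
  (p : w ∘ g = v ∘ u ∘ g) (q : w ∘ h = v ∘ u ∘ h) :
  w ◃ κ = eqcell (eq_sym q) • (v ◃ (u ◃ κ)) • eqcell p.
Proof.
case: _ / (eq_sym e) p q => p q.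
rewrite (eqcell_move (hcomp_assoc (idm v) (idm u) κ)) hcomp_id.
rewrite !cmp_assoc eqcell_cmp eqcell_id cmp_idl -cmp_assoc eqcell_cmp.
by rewrite eqcell_id cmp_idr.
Qed.

End Eqcell.

Program Definition id2F (C : TwoCat) : TwoFunctor C C :=
  {| fob := fun c => c; fhom := fun a b u => u; fcell := fun a b u v α => α |}.
Next Obligation. by rewrite /= cmp_idl cmp_idr. Qed.

Lemma comp2F_id (C D E : TwoCat) (G : TwoFunctor D E) (F : TwoFunctor C D) (a : C) :
  fhom G (fhom F (id1 a)) = id1 (G (F a)).
Proof. by rewrite !fhom_id. Qed.

Lemma comp2F_comp (C D E : TwoCat) (G : TwoFunctor D E) (F : TwoFunctor C D)
  (a b c : C) (v : hom b c) (u : hom a b) :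
  fhom G (fhom F (v ∘ u)) = fhom G (fhom F v) ∘ fhom G (fhom F u).
Proof. by rewrite !fhom_comp. Qed.

Program Definition comp2F (C D E : TwoCat) (G : TwoFunctor D E) (F : TwoFunctor C D) :
  TwoFunctor C E :=
  {| fob := fun c => G (F c);
     fhom := fun a b u => fhom G (fhom F u);
     fcell := fun a b u v α => fcell G (fcell F α);
     fhom_id := comp2F_id G F;
     fhom_comp := fun a b c => comp2F_comp G F (a:=a) (b:=b) (c:=c) |}.
Next Obligation. by rewrite !fcell_id. Qed.
Next Obligation. by rewrite !fcell_cmp. Qed.
Next Obligation.
have e (v0 : hom b c) (u0 : hom a b) : eqcell (comp2F_comp G F v0 u0)
    = eqcell (fhom_comp G (fhom F v0) (fhom F u0)) • fcell G (eqcell (fhom_comp F v0 u0)).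
  by rewrite fcell_eqcell eqcell_cmp; apply: eqcell_irr.
by rewrite !e -cmp_assoc -fcell_cmp fcell_hcomp fcell_cmp !cmp_assoc fcell_hcomp.
Qed.

Record MarkedTwoCat := {
  undertc :> TwoCat;
  marked : forall a b : undertc, hom a b -> Prop;
  marked_id : forall a : undertc, marked (id1 a)
}.
Arguments marked {m a b} _ : rename.

Record MarkedFunctor (C D : MarkedTwoCat) := {
  underfun :> TwoFunctor C D;
  fhom_marked : forall (a b : C) (u : hom a b), marked u -> marked (fhom underfun u)
}.

Definition idMF (C : MarkedTwoCat) : MarkedFunctor C C :=
  {| underfun := id2F C; fhom_marked := fun a b u mu => mu |}.

Section Slice.
Variables (C D : MarkedTwoCat) (f : MarkedFunctor C D) (d : D).

(** Following the oplax convention, a 1-cell from [(c, h)] to [(c', k)] carries a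
    2-cell [f(u) ∘ h ⇒ k], and a 2-cell from [(u, β)] to [(v, α)] is some [ν : u ⇒ v]
    with [α • (f(ν) ▹ h) = β]. *)
Record SliceOb := { pt : C; arr : hom d (f pt) }.

Record SliceMor (x y : SliceOb) := {
  smor : hom (pt x) (pt y);
  scell : fhom f smor ∘ arr x ⇒ arr y
}.

Definition SliceCell (x y : SliceOb) (s t : SliceMor x y) : Type :=
  {ν : smor s ⇒ smor t | scell t • (fcell f ν ▹ arr x) = scell s}.

Lemma SliceCell_eq (x y : SliceOb) (s t : SliceMor x y) (μ ν : SliceCell s t) :
  proj1_sig μ = proj1_sig ν -> μ = ν.
Proof.
case: μ ν => [m hm] [n hn] /= e; exact: subset_eq_compat.
Qed.

Program Definition SliceHom (x y : SliceOb) : Category :=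
  {| Ob := SliceMor x y;
     Hom := @SliceCell x y;
     idm := fun s => idm (smor s);
     cmp := fun r s t ν μ => proj1_sig ν • proj1_sig μ |}.
Next Obligation. by rewrite fcell_id hcomp_id cmp_idr. Qed.
Next Obligation.
case: ν μ => [n hn] [m hm] /=.
by rewrite fcell_cmp whiskr_cmp cmp_assoc hn hm.
Qed.
Next Obligation. apply: SliceCell_eq; exact: cmp_idl. Qed.
Next Obligation. apply: SliceCell_eq; exact: cmp_idr. Qed.
Next Obligation. apply: SliceCell_eq; exact: cmp_assoc. Qed.

Lemma slice_id_eq (x : SliceOb) : fhom f (id1 (pt x)) ∘ arr x = arr x.
Proof. by rewrite fhom_id comp1_idl. Qed.

Definition slice_id (x : SliceOb) : SliceHom x x :=
  {| smor := id1 (pt x); scell := eqcell (slice_id_eq x) |}.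

Lemma slice_comp_eq (a b c : C) (v : hom b c) (u : hom a b) (h : hom d (f a)) :
  fhom f (v ∘ u) ∘ h = fhom f v ∘ (fhom f u ∘ h).
Proof. by rewrite fhom_comp comp1_assoc. Qed.

Definition slice_comp (x y z : SliceOb) (t : SliceHom y z) (s : SliceHom x y) :
  SliceHom x z :=
  {| smor := smor t ∘ smor s;
     scell := scell t • (fhom f (smor t) ◃ scell s)
              • eqcell (slice_comp_eq (smor t) (smor s) (arr x)) |}.

Lemma slice_comp_nat (a b c : C) (v v' : hom b c) (u u' : hom a b) (h : hom d (f a))
  (β : v ⇒ v') (α : u ⇒ u') :
  eqcell (slice_comp_eq v' u' h) • (fcell f (β ⋆ α) ▹ h)
  = (fcell f β ⋆ (fcell f α ▹ h)) • eqcell (slice_comp_eq v u h).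
Proof.
rewrite (eqcell_move (fcell_hcomp f β α)) !whiskr_cmp !eqcell_whiskr.
have -> : (fcell f β ⋆ fcell f α) ▹ h = eqcell (comp1_assoc _ _ _)
   • (fcell f β ⋆ (fcell f α ▹ h)) • eqcell (eq_sym (comp1_assoc _ _ _)).
  by rewrite hcomp_assoc -cmp_assoc eqcell_cmp eqcell_id cmp_idr.
rewrite !cmp_assoc !eqcell_cmp eqcell_id cmp_idl -!cmp_assoc !eqcell_cmp.
by congr (_ • _); apply: eqcell_irr.
Qed.

Program Definition slice_hcomp (x y z : SliceOb) (t t' : SliceHom y z)
  (s s' : SliceHom x y) (ν' : t ⇒ t') (ν : s ⇒ s') :
  slice_comp t s ⇒ slice_comp t' s' := proj1_sig ν' ⋆ proj1_sig ν.
Next Obligation.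
case: ν ν' => [n hn] [n' hn'] /=.
rewrite -cmp_assoc slice_comp_nat cmp_assoc; congr (_ • _).
rewrite -cmp_assoc -interchange hn cmp_idl -hn' -cmp_assoc; congr (_ • _).
by rewrite -interchange cmp_idl cmp_idr.
Qed.

Lemma SliceMor_eq (x y : SliceOb) (s t : SliceMor x y) (p : smor s = smor t) :
  scell s = scell t • eqcell (f_equal (fun u => fhom f u ∘ arr x) p) -> s = t.
Proof.
case: s t p => [u β] [v γ] /= p.
case: _ / p γ => γ /=; rewrite cmp_idr => ->; by [].
Qed.

Lemma slice_eqcell (x y : SliceOb) (s t : SliceHom x y) (p : s = t) :
  proj1_sig (eqcell p) = eqcell (f_equal (@smor x y) p).
Proof. by case: _ / p. Qed.

Lemma slice_idl (x y : SliceOb) (s : SliceHom x y) : slice_comp (slice_id y) s = s.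
Proof.
apply: (@SliceMor_eq _ _ (slice_comp (slice_id y) s) s (comp1_idl (smor s))) => /=.
rewrite (whiskl_id1 (fhom_id f _) (scell s) (slice_id_eq (Build_SliceOb (fhom f (smor s) ∘ arr x))) (slice_id_eq y)).
rewrite !cmp_assoc eqcell_cmp eqcell_id cmp_idl -cmp_assoc eqcell_cmp.
by congr (_ • _); apply: eqcell_irr.
Qed.

Lemma slice_idr (x y : SliceOb) (s : SliceHom x y) : slice_comp s (slice_id x) = s.
Proof.
apply: (@SliceMor_eq _ _ (slice_comp s (slice_id x)) s (comp1_idr (smor s))) => /=.
rewrite eqcell_whiskl -cmp_assoc eqcell_cmp.
by congr (_ • _); apply: eqcell_irr.
Qed.

Lemma slice_assoc (x y z t : SliceOb) (r : SliceHom z t) (s : SliceHom y z)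
  (q : SliceHom x y) :
  slice_comp r (slice_comp s q) = slice_comp (slice_comp r s) q.
Proof.
apply: (@SliceMor_eq _ _ (slice_comp r (slice_comp s q)) (slice_comp (slice_comp r s) q)
          (comp1_assoc (smor r) (smor s) (smor q))) => /=.
rewrite !whiskl_cmp eqcell_whiskl.
rewrite -!cmp_assoc; congr (_ • (_ • _)).
rewrite (whiskl_comp1 (fhom_comp f _ _) (scell q) (slice_comp_eq _ _ _)
           (slice_comp_eq _ _ _)).
rewrite !cmp_assoc eqcell_cmp eqcell_id cmp_idl -!cmp_assoc !eqcell_cmp.
by congr (_ • _); apply: eqcell_irr.
Qed.

Lemma slice_cmpE (x y : SliceOb) (r s t : SliceHom x y) (ν : s ⇒ t) (μ : r ⇒ s) :
  proj1_sig (ν • μ) = proj1_sig ν • proj1_sig μ.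
Proof. by []. Qed.

Lemma slice_hcomp_idl (x y : SliceOb) (s t : SliceHom x y) (ν : s ⇒ t) :
  eqcell (slice_idl t) • slice_hcomp (idm (slice_id y)) ν = ν • eqcell (slice_idl s).
Proof.
apply: SliceCell_eq; rewrite !slice_cmpE !slice_eqcell.
rewrite (eqcell_irr (f_equal _ (slice_idl t)) (comp1_idl (smor t))).
rewrite (eqcell_irr (f_equal _ (slice_idl s)) (comp1_idl (smor s))).
exact: hcomp_idl.
Qed.

Lemma slice_hcomp_idr (x y : SliceOb) (s t : SliceHom x y) (ν : s ⇒ t) :
  eqcell (slice_idr t) • slice_hcomp ν (idm (slice_id x)) = ν • eqcell (slice_idr s).
Proof.
apply: SliceCell_eq; rewrite !slice_cmpE !slice_eqcell.
rewrite (eqcell_irr (f_equal _ (slice_idr t)) (comp1_idr (smor t))).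
rewrite (eqcell_irr (f_equal _ (slice_idr s)) (comp1_idr (smor s))).
exact: hcomp_idr.
Qed.

Lemma slice_hcomp_assoc (x y z t : SliceOb) (r r' : SliceHom z t) (s s' : SliceHom y z)
  (q q' : SliceHom x y) (γ : r ⇒ r') (β : s ⇒ s') (α : q ⇒ q') :
  eqcell (slice_assoc r' s' q') • slice_hcomp γ (slice_hcomp β α)
  = slice_hcomp (slice_hcomp γ β) α • eqcell (slice_assoc r s q).
Proof.
apply: SliceCell_eq; rewrite !slice_cmpE !slice_eqcell.
rewrite (eqcell_irr (f_equal _ (slice_assoc r' s' q'))
           (comp1_assoc (smor r') (smor s') (smor q'))).
rewrite (eqcell_irr (f_equal _ (slice_assoc r s q))
           (comp1_assoc (smor r) (smor s) (smor q))).
exact: hcomp_assoc.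
Qed.

Program Definition SliceTwoCat : TwoCat :=
  {| ob := SliceOb; hom := SliceHom; id1 := slice_id; comp1 := slice_comp;
     hcomp := slice_hcomp;
     comp1_idl := slice_idl; comp1_idr := slice_idr; comp1_assoc := slice_assoc;
     hcomp_idl := slice_hcomp_idl; hcomp_idr := slice_hcomp_idr;
     hcomp_assoc := slice_hcomp_assoc |}.
Next Obligation. apply: SliceCell_eq; exact: hcomp_id. Qed.
Next Obligation. apply: SliceCell_eq; exact: interchange. Qed.

Program Definition Slice : MarkedTwoCat :=
  {| undertc := SliceTwoCat;
     marked := fun x y (s : SliceHom x y) => marked (smor s) /\ is_iso (scell s) |}.
Next Obligation. by split; [exact: marked_id | exact: eqcell_iso]. Qed.

End Slice.

Arguments Slice {C D} f d.
Arguments SliceOb {C D} f d.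
Arguments Build_SliceOb {C D} f {d} pt arr.

Section Precomposition.
Variables (C D : MarkedTwoCat) (f : MarkedFunctor C D) (b d : D) (w : hom b d).

Definition precomp_ob (x : Slice f d) : Slice f b :=
  Build_SliceOb f (pt x) (arr x ∘ w).

Definition precomp_mor (x y : Slice f d) (s : hom x y) :
  hom (precomp_ob x) (precomp_ob y) :=
  {| smor := smor s : hom (pt (precomp_ob x)) (pt (precomp_ob y));
     scell := (scell s ▹ w) • eqcell (comp1_assoc (fhom f (smor s)) (arr x) w) |}.

Program Definition precomp_cell (x y : Slice f d) (s t : hom x y) (ν : s ⇒ t) :
  precomp_mor s ⇒ precomp_mor t := proj1_sig ν.
Next Obligation.
case: ν => ν /= <-.
by rewrite -hcomp_id -cmp_assoc hcomp_assoc cmp_assoc whiskr_cmp.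
Qed.

Lemma precomp_id (x : Slice f d) : precomp_mor (id1 x) = id1 (precomp_ob x).
Proof.
apply: (SliceMor_eq (s:=precomp_mor (id1 x)) (t:=id1 (precomp_ob x)) (p:=eq_refl)) => /=.
by rewrite eqcell_whiskr eqcell_cmp cmp_idr; apply: eqcell_irr.
Qed.

Lemma precomp_comp (x y z : Slice f d) (t : hom y z) (s : hom x y) :
  precomp_mor (t ∘ s) = precomp_mor t ∘ precomp_mor s.
Proof.
apply: (SliceMor_eq (s:=precomp_mor (t ∘ s)) (t:=precomp_mor t ∘ precomp_mor s) (p:=eq_refl)) => /=.
rewrite cmp_idr !whiskr_cmp whiskl_cmp eqcell_whiskr eqcell_whiskl -!cmp_assoc.
congr (_ • _); rewrite !eqcell_cmp !cmp_assoc hcomp_assoc -!cmp_assoc eqcell_cmp.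
by congr (_ • _); apply: eqcell_irr.
Qed.

Lemma precomp_hcomp (x y z : Slice f d) (t t' : hom y z) (s s' : hom x y)
  (β : t ⇒ t') (α : s ⇒ s') :
  eqcell (precomp_comp t' s') • precomp_cell (β ⋆ α)
  = (precomp_cell β ⋆ precomp_cell α) • eqcell (precomp_comp t s).
Proof.
apply: SliceCell_eq.
rewrite (slice_cmpE (eqcell (precomp_comp t' s'))).
rewrite (slice_cmpE (precomp_cell β ⋆ precomp_cell α)).
rewrite (slice_eqcell (precomp_comp t' s')) (slice_eqcell (precomp_comp t s)).
transitivity (proj1_sig β ⋆ proj1_sig α).
- etransitivity; last exact: cmp_idl.
  apply: (f_equal (fun e => e • _)); exact: (@eqcell_irr _ _ _ _ eq_refl).
- symmetry; etransitivity; last exact: cmp_idr.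
  apply: (f_equal (fun e => _ • e)); exact: (@eqcell_irr _ _ _ _ eq_refl).
Qed.

Program Definition precomp2F : TwoFunctor (Slice f d) (Slice f b) :=
  {| fob := precomp_ob : Slice f d -> Slice f b;
     fhom := precomp_mor; fcell := precomp_cell;
     fhom_id := precomp_id; fhom_comp := precomp_comp;
     fcell_hcomp := precomp_hcomp |}.
Next Obligation. exact: SliceCell_eq. Qed.
Next Obligation. exact: SliceCell_eq. Qed.

Program Definition precomp : MarkedFunctor (Slice f d) (Slice f b) :=
  {| underfun := precomp2F |}.
Next Obligation.
split=> //; apply: is_iso_cmp; last exact: eqcell_iso.
case: H0 => g [g1 g2]; exists (g ▹ w).
by rewrite -!whiskr_cmp g1 g2 !hcomp_id.
Qed.

End Precomposition.

Section Ho.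
Variable A : TwoCat.

(** Morphisms of [Ho A] are the connected components of the hom-categories of [A]. *)
Definition cell_rel (a b : A) (u v : hom a b) : Prop := inhabited (u ⇒ v).

Definition HoHom (a b : A) : Type := Quot (@cell_rel a b).

Definition ho_cls (a b : A) (u : hom a b) : HoHom a b := cls (@cell_rel a b) u.

Definition ho_cmp (a b c : A) (q : HoHom b c) (p : HoHom a b) : HoHom a c :=
  ho_cls (repr q ∘ repr p).

Lemma ho_cmpE (a b c : A) (v : hom b c) (u : hom a b) :
  ho_cmp (ho_cls v) (ho_cls u) = ho_cls (v ∘ u).
Proof.
apply: cls_eq; apply: (@rst_trans _ _ _ (repr (ho_cls v) ∘ u)).
- apply: clos_map (repr_cls _ u) => x y [α]; apply: rst_step; exact: (inhabits (_ ◃ α)).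
- apply: (clos_map (f:=fun x => x ∘ u)) (repr_cls _ v) => x y [α].
  apply: rst_step; exact: (inhabits (α ▹ _)).
Qed.

Program Definition Ho : Category :=
  {| Ob := A; Hom := HoHom; idm := fun a => ho_cls (id1 a); cmp := ho_cmp |}.
Next Obligation. by rewrite -(cls_repr f) ho_cmpE comp1_idl. Qed.
Next Obligation. by rewrite -(cls_repr f) ho_cmpE comp1_idr. Qed.
Next Obligation.
case: (cls_surj h) (cls_surj g) (cls_surj f) => [r ->] [s ->] [q ->].
by rewrite (ho_cmpE s q) (ho_cmpE r s) !ho_cmpE comp1_assoc.
Qed.

End Ho.

Program Definition Ho_map (A B : TwoCat) (F : TwoFunctor A B) : Functor (Ho A) (Ho B) :=
  {| fun_ob := fun a => F a : Ho B;
     fun_map := fun x y p => ho_cls (fhom F (repr p)) |}.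
Next Obligation.
rewrite -fhom_id; apply: cls_eq; apply: clos_map (repr_cls _ _) => u v [α].
apply: rst_step; exact: (inhabits (fcell F α)).
Qed.
Next Obligation.
rewrite ho_cmpE -fhom_comp; apply: cls_eq; apply: clos_map (repr_cls _ _) => u v [α].
apply: rst_step; exact: (inhabits (fcell F α)).
Qed.

Definition ho_marked (A : MarkedTwoCat) (a b : Ho A) (p : a ⇒ b) : Prop :=
  exists u : hom (t:=A) a b, marked u /\ p = ho_cls u.

Section Localization.
Variables (K : Category) (W : forall x y : K, x ⇒ y -> Prop).

(** [K[W^-1]] is presented by generators and relations: its morphisms are the formal
    composites of morphisms of [K] and formal inverses of morphisms in [W], modulo
    the equivalence relation generated by [loc_rel]. *)
Inductive LocTerm : K -> K -> Type :=
| lt_mor : forall x y : K, x ⇒ y -> LocTerm x y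
| lt_inv : forall (x y : K) (w : x ⇒ y), W w -> LocTerm y x
| lt_cmp : forall x y z : K, LocTerm y z -> LocTerm x y -> LocTerm x z.

Inductive loc_rel : forall x y : K, LocTerm x y -> LocTerm x y -> Prop :=
| lr_idl : forall (x y : K) (t : LocTerm x y), loc_rel (lt_cmp (lt_mor (idm y)) t) t
| lr_idr : forall (x y : K) (t : LocTerm x y), loc_rel (lt_cmp t (lt_mor (idm x))) t
| lr_assoc : forall (x y z u : K) (r : LocTerm z u) (s : LocTerm y z) (t : LocTerm x y),
    loc_rel (lt_cmp r (lt_cmp s t)) (lt_cmp (lt_cmp r s) t)
| lr_mor : forall (x y z : K) (g : y ⇒ z) (f : x ⇒ y),
    loc_rel (lt_cmp (lt_mor g) (lt_mor f)) (lt_mor (g • f))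
| lr_invl : forall (x y : K) (w : x ⇒ y) (Ww : W w),
    loc_rel (lt_cmp (lt_inv Ww) (lt_mor w)) (lt_mor (idm x))
| lr_invr : forall (x y : K) (w : x ⇒ y) (Ww : W w),
    loc_rel (lt_cmp (lt_mor w) (lt_inv Ww)) (lt_mor (idm y))
| lr_congl : forall (x y z : K) (s s' : LocTerm y z) (t : LocTerm x y),
    loc_rel s s' -> loc_rel (lt_cmp s t) (lt_cmp s' t)
| lr_congr : forall (x y z : K) (s : LocTerm y z) (t t' : LocTerm x y),
    loc_rel t t' -> loc_rel (lt_cmp s t) (lt_cmp s t').

Definition LocHom (x y : K) : Type := Quot (@loc_rel x y).

Definition loc_cls (x y : K) (t : LocTerm x y) : LocHom x y := cls (@loc_rel x y) t.

Definition loc_cmp (x y z : K) (q : LocHom y z) (p : LocHom x y) : LocHom x z :=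
  loc_cls (lt_cmp (repr q) (repr p)).

Lemma loc_cmpE (x y z : K) (s : LocTerm y z) (t : LocTerm x y) :
  loc_cmp (loc_cls s) (loc_cls t) = loc_cls (lt_cmp s t).
Proof.
apply: cls_eq; apply: (@rst_trans _ _ _ (lt_cmp (repr (loc_cls s)) t)).
- apply: clos_map (repr_cls _ t) => u v h; apply: rst_step; exact: lr_congr.
- apply: (clos_map (f:=fun r => lt_cmp r t)) (repr_cls _ s) => u v h.
  apply: rst_step; exact: lr_congl.
Qed.

Program Definition Loc : Category :=
  {| Ob := K; Hom := LocHom; idm := fun x => loc_cls (lt_mor (idm x)); cmp := loc_cmp |}.
Next Obligation.
rewrite -(cls_repr f) loc_cmpE; apply: cls_eq; apply: rst_step; exact: lr_idl.
Qed.
Next Obligation.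
rewrite -(cls_repr f) loc_cmpE; apply: cls_eq; apply: rst_step; exact: lr_idr.
Qed.
Next Obligation.
case: (cls_surj h) (cls_surj g) (cls_surj f) => [r ->] [s ->] [q ->].
rewrite (loc_cmpE s q) (loc_cmpE r s) !loc_cmpE; apply: cls_eq; apply: rst_step; exact: lr_assoc.
Qed.

End Localization.

Section LocalizationMap.
Variables (K L : Category) (W : forall x y : K, x ⇒ y -> Prop)
  (V : forall x y : L, x ⇒ y -> Prop) (F : Functor K L)
  (FW : forall (x y : K) (w : x ⇒ y), W w -> V (fun_map F w)).

Fixpoint lt_map (x y : K) (t : LocTerm W x y) : LocTerm V (F x) (F y) :=
  match t with
  | lt_mor _ g => lt_mor V (fun_map F g)
  | lt_inv Ww => lt_inv (FW Ww)
  | lt_cmp s t => lt_cmp (lt_map s) (lt_map t)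
  end.

Lemma lt_map_rel (x y : K) (s t : LocTerm W x y) :
  clos_refl_sym_trans _ (@loc_rel K W x y) s t ->
  clos_refl_sym_trans _ (@loc_rel L V (F x) (F y)) (lt_map s) (lt_map t).
Proof.
apply: clos_map => {}s {}t h; apply: rst_step; elim: h => {x y s t} /=.
- by move=> x y t; rewrite fun_map_id; apply: lr_idl.
- by move=> x y t; rewrite fun_map_id; apply: lr_idr.
- by move=> x y z u r s t; apply: lr_assoc.
- by move=> x y z g f; rewrite fun_map_cmp; apply: lr_mor.
- by move=> x y w Ww; rewrite fun_map_id; apply: lr_invl.
- by move=> x y w Ww; rewrite fun_map_id; apply: lr_invr.
- by move=> x y z s s' t _ h; apply: lr_congl.
- by move=> x y z s t t' _ h; apply: lr_congr.
Qed.

Program Definition Loc_map : Functor (Loc W) (Loc V) :=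
  {| fun_ob := fun x => F x : Loc V;
     fun_map := fun x y p => loc_cls (lt_map (repr p)) |}.
Next Obligation.
rewrite -fun_map_id; apply: cls_eq; exact: lt_map_rel (repr_cls _ _).
Qed.
Next Obligation.
rewrite loc_cmpE; apply: cls_eq; exact: lt_map_rel (repr_cls _ _).
Qed.

End LocalizationMap.

Definition HoLoc (A : MarkedTwoCat) : Category := Loc (@ho_marked A).

Lemma Ho_map_marked (A B : MarkedTwoCat) (F : MarkedFunctor A B) (x y : Ho A)
  (p : x ⇒ y) : ho_marked p -> ho_marked (fun_map (Ho_map F) p).
Proof.
move=> [u [mu ->]]; exists (fhom F u); split; first exact: fhom_marked.
apply: cls_eq; apply: clos_map (repr_cls _ _) => v v' [α].
apply: rst_step; exact: (inhabits (fcell F α)).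
Qed.

Definition HoLoc_map (A B : MarkedTwoCat) (F : MarkedFunctor A B) :
  Functor (HoLoc A) (HoLoc B) := Loc_map (@Ho_map_marked A B F).

Section Cocones.
Variables (B : MarkedTwoCat) (A : TwoCat) (F : TwoFunctor B A) (a : A).

Lemma cocone_id_eq (b : B) (l : hom (F b) a) : l = l ∘ fhom F (id1 b).
Proof. by rewrite fhom_id comp1_idr. Qed.

Lemma cocone_comp_eq (b b' b'' : B) (l : hom (F b'') a) (v : hom b' b'')
  (u : hom b b') : (l ∘ fhom F v) ∘ fhom F u = l ∘ fhom F (v ∘ u).
Proof. by rewrite fhom_comp comp1_assoc. Qed.

(** [CoconeCat F a] is the category of 2-natural transformations, and modifications
    between them, from [b ↦ ho(B_{b↑})[W^-1]] to [A(F(-), a)], in its explicit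
    description; [eqcell] accounts for [leg b = leg b ∘ F(id)] and
    [(leg b'' ∘ F(v)) ∘ F(u) = leg b'' ∘ F(v ∘ u)]. *)
Record Cocone := {
  leg : forall b : B, hom (F b) a;
  legcell : forall (b b' : B) (u : hom b b'), leg b ⇒ leg b' ∘ fhom F u;
  legcell_marked : forall (b b' : B) (u : hom b b'), marked u -> is_iso (legcell u);
  legcell_id : forall b : B, legcell (id1 b) = eqcell (cocone_id_eq (leg b));
  legcell_comp : forall (b b' b'' : B) (v : hom b' b'') (u : hom b b'),
    legcell (v ∘ u)
    = eqcell (cocone_comp_eq (leg b'') v u) • ((legcell v ▹ fhom F u) • legcell u);
  legcell_nat : forall (b b' : B) (u w : hom b b') (β : u ⇒ w),
    (leg b' ◃ fcell F β) • legcell u = legcell w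
}.

Definition CoconeHom (α β : Cocone) : Type :=
  {ε : forall b : B, leg α b ⇒ leg β b |
    forall (b b' : B) (u : hom b b'),
      legcell β u • ε b = (ε b' ▹ fhom F u) • legcell α u}.

Lemma CoconeHom_eq (α β : Cocone) (ε ζ : CoconeHom α β) :
  (forall b, proj1_sig ε b = proj1_sig ζ b) -> ε = ζ.
Proof.
case: ε ζ => [e He] [z Hz] /= h; apply: subset_eq_compat.
exact: functional_extensionality_dep.
Qed.

Program Definition CoconeCat : Category :=
  {| Ob := Cocone; Hom := CoconeHom;
     idm := fun α b => idm (leg α b);
     cmp := fun α β γ ζ ε b => proj1_sig ζ b • proj1_sig ε b |}.
Next Obligation. by rewrite hcomp_id cmp_idl cmp_idr. Qed.
Next Obligation.
case: ε ζ => [e He] [z Hz] /=.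
by rewrite cmp_assoc Hz -cmp_assoc He cmp_assoc whiskr_cmp.
Qed.
Next Obligation. apply: CoconeHom_eq => b; exact: cmp_idl. Qed.
Next Obligation. apply: CoconeHom_eq => b; exact: cmp_idr. Qed.
Next Obligation. apply: CoconeHom_eq => b; exact: cmp_assoc. Qed.

End Cocones.

Section Restriction.
Variables (C D : MarkedTwoCat) (f : MarkedFunctor C D)
  (A : TwoCat) (F : TwoFunctor D A) (a : A).

Lemma legcell_eq (α : Cocone F a) (d d' : D) (u w : hom d d') (p : u = w) :
  legcell α w = eqcell (f_equal (fun x => leg α d' ∘ fhom F x) p) • legcell α u.
Proof. by case: _ / p; rewrite /= cmp_idl. Qed.

Program Definition restr_ob (α : Cocone F a) : Cocone (B:=C) (comp2F F f) a :=
  {| leg := fun c => leg α (f c);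
     legcell := fun c c' u => legcell α (fhom f u) |}.
Next Obligation. by apply: legcell_marked; apply: fhom_marked. Qed.
Next Obligation.
rewrite (legcell_eq α (eq_sym (fhom_id f b))) legcell_id eqcell_cmp.
exact: eqcell_irr.
Qed.
Next Obligation.
rewrite (legcell_eq α (eq_sym (fhom_comp f v u))) legcell_comp cmp_assoc eqcell_cmp.
by congr (_ • _); apply: eqcell_irr.
Qed.
Next Obligation. exact: legcell_nat. Qed.

Program Definition restr_map (α β : Cocone F a) (ε : CoconeHom α β) :
  CoconeHom (restr_ob α) (restr_ob β) := fun c => proj1_sig ε (f c).
Next Obligation. exact: (proj2_sig ε). Qed.

Program Definition restr :
  Functor (CoconeCat F a) (CoconeCat (B:=C) (comp2F F f) a) :=
  {| fun_ob := restr_ob : CoconeCat F a -> CoconeCat (B:=C) (comp2F F f) a;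
     fun_map := restr_map |}.
Next Obligation. exact: CoconeHom_eq. Qed.
Next Obligation. exact: CoconeHom_eq. Qed.

End Restriction.

(** [C], [D] and [A] range over the 2-categories of one fixed universe, so that [A] may
    be large compared with [C] and [D]. *)
Definition MarkedCofinal (C D : MarkedTwoCat) (f : MarkedFunctor C D) : Prop :=
  forall (A : TwoCat) (F : TwoFunctor D A) (a : A), IsEquivalence (restr f F a).

(* Main.v *)
From Stdlib Require Import ssreflect Relations ProofIrrelevance.
From Stdlib Require Import FunctionalExtensionality IndefiniteDescription.
Require Import Defs.

(** For [d] in [D] write [P d] and [Q d] for the localized homotopy categories of the slices
    of [C] and of [D] under [d]. Precomposition makes both strict 2-functors of [d], and
    [push : P d → Q d], [(c, h) ↦ (f c, h)], is natural. A marked cocone [γ] over [C] with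
    vertex [a] is the same as a 2-natural transformation [yon γ : P d → A(F d, a)],
    [(c, h) ↦ γ_c ∘ F h], and likewise cocones over [D] are transformations out of [Q];
    restriction of cocones is restriction along [push] ([yon_push]). Cofinality therefore
    means that [push] is an equivalence, and the three conditions say this in terms of initial
    objects, since the identity of [d] is initial in [Q d] ([id_initial]).

    Sufficiency. Let [g d] be initial in both slices. A transformation out of [Q] is determined
    by its values at the identities, hence up to isomorphism at the [g d]. So a cocone [γ] on
    [C] extends to [D] by the legs [yon γ (g d)]; its cells are the images of the unique maps
    [g d ⇒ u^* (g d')], uniqueness gives all laws, and preservation of initial objects makes
    the cells over marked morphisms invertible ([ext]). The restriction of this extension
    is isomorphic to [γ] because the identity of [f c], being marked, is initial in [P (f c)]
    as well ([restr_surjective]). In the same way a morphism between restricted cocones has a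
    unique extension, whose component at [d] is transported along [id ≅ g d] ([restr_full],
    [restr_faithful]).

    Necessity. Cofinality is tested on 2-categories with [A(F d, a)] isomorphic to [P d] or to
    [Q d]: the full sub-2-category of [Cat] on the slices and the terminal category, with
    1-morphisms reversed ([CatOn]). The universal cocone on [C], with values [(c, id)] in
    [P (f c)], is the restriction of a cocone [α] on [D] up to isomorphism; let [p d] in [P d]
    be its values. The objects [push (p d)] and [id] of [Q d] form two cocones on [D] whose
    restrictions to [C] are isomorphic, so [push (p d)] is initial ([push_point_initial]). On
    the other hand [yon α : Q d → P d] is a left inverse of [push] up to isomorphism, because
    [yon α ∘ push] is the transformation of the restriction of [α], that is of the universal
    cocone ([retraction_iso]). Hence [push] reflects initial objects. This makes [p d] initial
    in both slices and marked morphisms [d → f c] initial in [P d], and the cells of [α] over a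
    marked [w : b → d] are isomorphisms [p b ≅ w^* (p d)], so that [w^*] preserves initial
    objects. *)

Set Implicit Arguments.
Unset Strict Implicit.
Unset Printing Implicit Defensive.

(** * Isomorphisms, initial objects and equivalences *)

Section Isos.
Variable K : Category.
Implicit Types x y z : K.

Lemma iso_mono x y z (i : y ⇒ z) (f g : x ⇒ y) : is_iso i -> i • f = i • g -> f = g.
Proof. by move=> [j [ji _]] e; rewrite -(cmp_idl f) -(cmp_idl g) -ji -!cmp_assoc e. Qed.

Lemma iso_epi x y z (i : x ⇒ y) (f g : y ⇒ z) : is_iso i -> f • i = g • i -> f = g.
Proof. by move=> [j [_ ij]] e; rewrite -(cmp_idr f) -(cmp_idr g) -ij !cmp_assoc e. Qed.

Definition iso_inv x y (f : x ⇒ y) (h : is_iso f) : y ⇒ x :=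
  proj1_sig (constructive_indefinite_description _ h).

Lemma iso_invl x y (f : x ⇒ y) (h : is_iso f) : iso_inv h • f = idm x.
Proof. by rewrite /iso_inv; case: constructive_indefinite_description => g /= []. Qed.

Lemma iso_invr x y (f : x ⇒ y) (h : is_iso f) : f • iso_inv h = idm y.
Proof. by rewrite /iso_inv; case: constructive_indefinite_description => g /= []. Qed.

Lemma is_iso_inv x y (f : x ⇒ y) (h : is_iso f) : is_iso (iso_inv h).
Proof. by exists f; rewrite iso_invl iso_invr. Qed.

Definition Iso x y : Prop := exists i : x ⇒ y, is_iso i.

Lemma Iso_sym x y : Iso x y -> Iso y x.
Proof. by move=> [i hi]; exists (iso_inv hi); apply: is_iso_inv. Qed.

Lemma Iso_trans x y z : Iso x y -> Iso y z -> Iso x z.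
Proof. by move=> [i hi] [j hj]; exists (j • i); apply: is_iso_cmp. Qed.

Lemma Initial_eq x y (f g : x ⇒ y) : Initial x -> f = g.
Proof. by move=> /(_ y) [m hm]; rewrite (hm f) (hm g). Qed.

Definition initial_map x (hx : Initial x) y : x ⇒ y :=
  proj1_sig (constructive_indefinite_description _ (hx y)).

Lemma Initial_Iso x y : Initial x -> Iso x y -> Initial y.
Proof.
move=> hx [i hi] z; exists (initial_map hx z • iso_inv hi) => m.
by apply: (iso_epi hi); apply: Initial_eq.
Qed.

Lemma Initial_is_iso x y (f : x ⇒ y) : Initial x -> Initial y -> is_iso f.
Proof. by move=> hx hy; exists (initial_map hy x); split; apply: Initial_eq. Qed.

End Isos.

Lemma fun_map_iso (K L : Category) (F : Functor K L) (x y : K) (f : x ⇒ y) :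
  is_iso f -> is_iso (fun_map F f).
Proof.
by move=> [g [gf fg]]; exists (fun_map F g); rewrite -!fun_map_cmp gf fg !fun_map_id.
Qed.

Lemma fun_Iso (K L : Category) (F : Functor K L) (x y : K) : Iso x y -> Iso (F x) (F y).
Proof. by move=> [i hi]; exists (fun_map F i); apply: fun_map_iso. Qed.

Lemma fun_map_eqcell (K L : Category) (F : Functor K L) (x y : K) (p : x = y) :
  fun_map F (eqcell p) = eqcell (f_equal (fun_ob F) p).
Proof. by case: _ / p; rewrite /= fun_map_id. Qed.

Lemma equivalence_Iso (K L : Category) (F : Functor K L) (x y : K) :
  IsEquivalence F -> Iso (F x) (F y) -> Iso x y.
Proof.
move=> [G [[η [hη _]] _]] h.
apply: (Iso_trans (y := G (F x))); first by apply: Iso_sym; exists (η x); apply: hη.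
apply: (Iso_trans (y := G (F y))); first exact: (fun_Iso G).
by exists (η y); apply: hη.
Qed.

Lemma equivalence_surj (K L : Category) (F : Functor K L) (y : L) :
  IsEquivalence F -> exists x, Iso (F x) y.
Proof. by move=> [G [_ [η [hη _]]]]; exists (G y), (η y); apply: hη. Qed.

(** The quasi-inverse picks a preimage of every object up to isomorphism, and preimages
    of morphisms. *)
Lemma full_faithful_surj_equivalence (K L : Category) (F : Functor K L) :
  (forall x y (g : F x ⇒ F y), exists f, fun_map F f = g) ->
  (forall x y (f f' : x ⇒ y), fun_map F f = fun_map F f' -> f = f') ->
  (forall y, exists x, Iso (F x) y) ->
  IsEquivalence F.
Proof.
move=> full faith surj.
pose R y := proj1_sig (constructive_indefinite_description _ (surj y)).
have hR y : Iso (F (R y)) y.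
  by rewrite /R; case: constructive_indefinite_description.
pose i y : F (R y) ⇒ y := proj1_sig (constructive_indefinite_description _ (hR y)).
have hi y : is_iso (i y) by rewrite /i; case: constructive_indefinite_description.
pose M x y (g : F x ⇒ F y) : x ⇒ y :=
  proj1_sig (constructive_indefinite_description _ (full x y g)).
have FM x y (g : F x ⇒ F y) : fun_map F (M x y g) = g.
  by rewrite /M; case: constructive_indefinite_description.
pose Gm x y (g : x ⇒ y) : R x ⇒ R y := M _ _ (iso_inv (hi y) • g • i x).
have Gid x : Gm x x (idm x) = idm (R x).
  by apply: faith; rewrite FM cmp_idr iso_invl fun_map_id.
have Gcmp x y z (g : y ⇒ z) (h : x ⇒ y) : Gm x z (g • h) = Gm y z g • Gm x y h.
  apply: faith; rewrite fun_map_cmp !FM !cmp_assoc; congr (_ • _ • _).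
  by rewrite -!(cmp_assoc (iso_inv (hi z) • g)) iso_invr cmp_idr.
exists (Build_Functor Gid Gcmp); split.
- exists (fun x => M _ _ (i (F x))); split=> [x|x y g] /=.
  + exists (M _ _ (iso_inv (hi (F x)))).
    by split; apply: faith; rewrite fun_map_cmp fun_map_id !FM ?iso_invl ?iso_invr.
  + by apply: faith; rewrite !fun_map_cmp !FM !cmp_assoc iso_invr cmp_idl.
- exists i; split=> [//|x y g] /=.
  by rewrite FM !cmp_assoc iso_invr cmp_idl.
Qed.

(** A retraction up to isomorphism makes [F] faithful, which gives uniqueness of maps out
    of [i]; a map [i ⇒ x] is recovered by applying [G] to the map [F i ⇒ F x]. *)
Lemma retract_reflects_initial (K L : Category) (F : Functor K L) (G : Functor L K) (i : K) :
  NatIso (compF G F) (idF K) -> Initial (F i) -> Initial i.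
Proof.
move=> [η' [hη' nat']] hi x.
have [η [hη nat]] : exists η : forall x : K, G (F x) ⇒ x, (forall x, is_iso (η x)) /\
    (forall (x y : K) (f : x ⇒ y), η y • fun_map G (fun_map F f) = f • η x).
  by exists η'.
exists (η x • fun_map G (initial_map hi (F x)) • iso_inv (hη i)) => m.
apply: (iso_epi (hη i)); rewrite -cmp_assoc iso_invl cmp_idr -nat.
by congr (_ • fun_map G _); apply: Initial_eq.
Qed.

(** * Equality of cells up to identities *)

(** Strict associativity and unitality, and strict functoriality, identify 1-cells that are
    not convertible. This relation compares 2-cells whose boundaries agree only up to such
    identifications, so that the mediating [eqcell]s can be dropped one at a time instead
    of being composed explicitly. Between parallel cells it is plain equality. *)
Definition heq (K : Category) (x y x' y' : K) (f : x ⇒ y) (g : x' ⇒ y') : Prop :=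
  exists (p : x = x') (q : y = y'), eqcell q • f = g • eqcell p.
Notation "f ≈ g" := (heq f g) (at level 70, no associativity) : twocat_scope.

Section HEq.
Variable K : Category.
Implicit Types x y z : K.

Lemma heq_refl x y (f : x ⇒ y) : f ≈ f.
Proof. by exists eq_refl, eq_refl; rewrite /= cmp_idl cmp_idr. Qed.

Lemma heq_of_eq x y (f g : x ⇒ y) : f = g -> f ≈ g.
Proof. by move=> ->; apply: heq_refl. Qed.

Lemma heq_eq x y (f g : x ⇒ y) : f ≈ g -> f = g.
Proof. by move=> [p [q]]; rewrite !eqcell_id cmp_idl cmp_idr. Qed.

Lemma heq_sym x y x' y' (f : x ⇒ y) (g : x' ⇒ y') : f ≈ g -> g ≈ f.
Proof.
move=> [p [q]]; destruct p, q => /=.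
by rewrite cmp_idl cmp_idr => ->; apply: heq_refl.
Qed.

Lemma heq_trans x y x' y' x'' y'' (g : x' ⇒ y') (f : x ⇒ y) (h : x'' ⇒ y'') :
  f ≈ g -> g ≈ h -> f ≈ h.
Proof.
move=> [p [q]]; destruct p, q => /=.
by rewrite cmp_idl cmp_idr => ->.
Qed.

Lemma heq_cmp x y z x' y' z' (g : y ⇒ z) (f : x ⇒ y) (g' : y' ⇒ z') (f' : x' ⇒ y') :
  g ≈ g' -> f ≈ f' -> g • f ≈ g' • f'.
Proof.
move=> [p [q]]; destruct p, q => /=.
rewrite cmp_idl cmp_idr => -> [p [q]]; destruct p.
by rewrite (eqcell_id q) /= cmp_idl cmp_idr => ->; apply: heq_refl.
Qed.

Lemma heq_eqcell x y (p : x = y) : eqcell p ≈ idm x.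
Proof. by case: _ / p; apply: heq_refl. Qed.

Lemma heq_eqcells x y (p : x = y) x' y' (q : x' = y') : x = x' -> eqcell p ≈ eqcell q.
Proof. by case: _ / p; case: _ / q => ->; apply: heq_refl. Qed.

Lemma heq_eql x y z (p : y = z) (f : x ⇒ y) x' y' (g : x' ⇒ y') :
  f ≈ g -> eqcell p • f ≈ g.
Proof. by case: _ / p; rewrite /= cmp_idl. Qed.

Lemma heq_eqr x y z (p : x = y) (f : y ⇒ z) x' y' (g : x' ⇒ y') :
  f ≈ g -> f • eqcell p ≈ g.
Proof. by destruct p; rewrite /= cmp_idr. Qed.

End HEq.

Lemma heq_fun (K L : Category) (F : Functor K L) (x y x' y' : K) (f : x ⇒ y) (g : x' ⇒ y') :
  f ≈ g -> fun_map F f ≈ fun_map F g.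
Proof.
move=> [p [q]]; destruct p, q => /=.
by rewrite cmp_idl cmp_idr => ->; apply: heq_refl.
Qed.

Lemma heq_hcomp (A : TwoCat) (a b c : A) (g g' h h' : hom b c) (k k' l l' : hom a b)
  (β : g ⇒ g') (β' : h ⇒ h') (α : k ⇒ k') (α' : l ⇒ l') :
  β ≈ β' -> α ≈ α' -> β ⋆ α ≈ β' ⋆ α'.
Proof.
move=> [p [q]]; destruct p, q => /=.
rewrite cmp_idl cmp_idr => -> [p [q]]; destruct p, q => /=.
by rewrite cmp_idl cmp_idr => ->; apply: heq_refl.
Qed.

Lemma heq_whiskl (A : TwoCat) (a b c : A) (g : hom b c) (k k' l l' : hom a b)
  (α : k ⇒ k') (α' : l ⇒ l') : α ≈ α' -> g ◃ α ≈ g ◃ α'.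
Proof. by apply: heq_hcomp; apply: heq_refl. Qed.

Lemma heq_whiskr (A : TwoCat) (a b c : A) (g g' h h' : hom b c) (k : hom a b)
  (β : g ⇒ g') (β' : h ⇒ h') : β ≈ β' -> β ▹ k ≈ β' ▹ k.
Proof. by move=> h1; apply: heq_hcomp => //; apply: heq_refl. Qed.

Lemma heq_idm (K : Category) (x y : K) : x = y -> idm x ≈ idm y.
Proof. by move=> ->; apply: heq_refl. Qed.

Lemma heq_assoc (A : TwoCat) (a b c d : A) (h h' : hom c d) (g g' : hom b c)
  (k k' : hom a b) (γ : h ⇒ h') (β : g ⇒ g') (α : k ⇒ k') :
  γ ⋆ (β ⋆ α) ≈ (γ ⋆ β) ⋆ α.
Proof. by exists (comp1_assoc _ _ _), (comp1_assoc _ _ _); apply: hcomp_assoc. Qed.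

Lemma heq_unitl (A : TwoCat) (a b : A) (w : hom b b) (g g' : hom a b) (α : g ⇒ g') :
  w = id1 b -> w ◃ α ≈ α.
Proof. by move=> ->; exists (comp1_idl _), (comp1_idl _); apply: hcomp_idl. Qed.

Lemma heq_unitr (A : TwoCat) (a b : A) (w : hom a a) (g g' : hom a b) (α : g ⇒ g') :
  w = id1 a -> α ▹ w ≈ α.
Proof. by move=> ->; exists (comp1_idr _), (comp1_idr _); apply: hcomp_idr. Qed.

Lemma heq_fcell_hcomp (A B : TwoCat) (F : TwoFunctor A B) (a b c : A) (g g' : hom b c)
  (k k' : hom a b) (β : g ⇒ g') (α : k ⇒ k') : fcell F (β ⋆ α) ≈ fcell F β ⋆ fcell F α.
Proof. by exists (fhom_comp F _ _), (fhom_comp F _ _); apply: fcell_hcomp. Qed.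

(** * Functors out of the localized homotopy category *)

Section LocalizationUniversal.
Variables (K L : Category) (W : forall x y : K, x ⇒ y -> Prop).

Section Lift.
Variables (G : Functor K L)
  (GW : forall (x y : K) (w : x ⇒ y), W w -> is_iso (fun_map G w)).

Fixpoint lt_eval (x y : K) (t : LocTerm W x y) : G x ⇒ G y :=
  match t with
  | lt_mor _ g => fun_map G g
  | lt_inv Ww => iso_inv (GW Ww)
  | lt_cmp s t => lt_eval s • lt_eval t
  end.

Lemma lt_eval_rel (x y : K) (s t : LocTerm W x y) :
  clos_refl_sym_trans _ (@loc_rel K W x y) s t -> lt_eval s = lt_eval t.
Proof.
elim=> {s t} [s t h|//|s t _ -> //|r s t _ -> _ -> //].
elim: h => {x y s t} //=.
- by move=> x y t; rewrite fun_map_id cmp_idl.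
- by move=> x y t; rewrite fun_map_id cmp_idr.
- by move=> *; rewrite cmp_assoc.
- by move=> *; rewrite fun_map_cmp.
- by move=> *; rewrite fun_map_id iso_invl.
- by move=> *; rewrite fun_map_id iso_invr.
- by move=> x y z s s' t _ ->.
- by move=> x y z s t t' _ ->.
Qed.

Program Definition Loc_lift : Functor (Loc W) L :=
  {| fun_ob := fun x => G x; fun_map := fun x y p => lt_eval (repr p) |}.
Next Obligation.
rewrite -fun_map_id -[fun_map G _]/(lt_eval (lt_mor _ (idm x))).
exact: lt_eval_rel (repr_cls _ _).
Qed.
Next Obligation. by rewrite (lt_eval_rel (repr_cls _ _)). Qed.

Lemma Loc_liftE (x y : K) (g : x ⇒ y) :
  fun_map Loc_lift (loc_cls (lt_mor W g)) = fun_map G g.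
Proof. exact: lt_eval_rel (repr_cls _ _). Qed.

End Lift.

Lemma loc_cls_cmp (x y z : K) (s : LocTerm W y z) (t : LocTerm W x y) :
  (loc_cls (lt_cmp s t) : @Hom (Loc W) x z) =
  @cmp (Loc W) x y z (loc_cls s) (loc_cls t).
Proof. by rewrite /= loc_cmpE. Qed.

(** A square that commutes for [w] also commutes for the inverse of [w], so naturality needs
    to be checked only on the morphisms that come from [K]. *)
Lemma Loc_natural (G H : Functor (Loc W) L) (η : forall x : K, G x ⇒ H x) :
  (forall (x y : K) (g : x ⇒ y),
    η y • fun_map G (loc_cls (lt_mor W g)) = fun_map H (loc_cls (lt_mor W g)) • η x) ->
  forall (x y : Loc W) (p : x ⇒ y), η y • fun_map G p = fun_map H p • η x.
Proof.
move=> nat x y p; case: (cls_surj p) => t ->; rewrite -/(loc_cls t).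
elim: t => {x y p} [x y g|x y w Ww|x y z s IHs t IHt]; first exact: nat.
- pose a : @Hom (Loc W) x y := loc_cls (lt_mor W w).
  pose b : @Hom (Loc W) y x := loc_cls (lt_inv Ww).
  have ba : b • a = idm _.
    by rewrite /a /b -loc_cls_cmp; apply: cls_eq; apply: rst_step; apply: lr_invl.
  have ab : a • b = idm _.
    by rewrite /a /b -loc_cls_cmp; apply: cls_eq; apply: rst_step; apply: lr_invr.
  have e : η y • fun_map G a = fun_map H a • η x := nat x y w.
  change (η x • fun_map G b = fun_map H b • η y).
  rewrite -[LHS]cmp_idl -(fun_map_id H x) -ba fun_map_cmp -cmp_assoc.
  rewrite (cmp_assoc _ (η x)) -e -!cmp_assoc.
  congr (_ • _); etransitivity; last exact: (cmp_idr (η y)).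
  by congr (_ • _); rewrite -fun_map_cmp ab fun_map_id.
- by rewrite loc_cls_cmp (fun_map_cmp G) (fun_map_cmp H) cmp_assoc IHs -!cmp_assoc IHt.
Qed.

End LocalizationUniversal.

Section HoLocTheory.
Variable A : MarkedTwoCat.

Definition loc_mor (x y : A) (u : hom x y) : @Hom (HoLoc A) x y :=
  loc_cls (lt_mor (@ho_marked A) (ho_cls u)).

Lemma loc_mor_cmp (x y z : A) (v : hom y z) (u : hom x y) : loc_mor v • loc_mor u = loc_mor (v ∘ u).
Proof.
rewrite /loc_mor /= loc_cmpE -ho_cmpE; apply: cls_eq; apply: rst_step; exact: lr_mor.
Qed.

Lemma loc_mor_cell (x y : A) (u v : hom x y) (ν : u ⇒ v) : loc_mor u = loc_mor v.
Proof.
congr (loc_cls (lt_mor _ _)); apply: cls_eq; apply: rst_step; exact: (inhabits ν).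
Qed.

Lemma loc_mor_marked (x y : A) (u : hom x y) : marked u -> is_iso (loc_mor u).
Proof.
move=> mu.
have Wu : ho_marked (ho_cls u : @Hom (Ho A) x y) by exists u.
exists (loc_cls (lt_inv Wu)); split.
- by rewrite -loc_cls_cmp; apply: cls_eq; apply: rst_step; apply: lr_invl.
- by rewrite -loc_cls_cmp; apply: cls_eq; apply: rst_step; apply: lr_invr.
Qed.

Lemma loc_mor_surj (x y : A) (p : @Hom (Ho A) x y) : exists u : hom x y, p = ho_cls u.
Proof. exact: cls_surj. Qed.

Lemma HoLoc_natural (L : Category) (G H : Functor (HoLoc A) L) (η : forall x : A, G x ⇒ H x) :
  (forall (x y : A) (u : hom x y), η y • fun_map G (loc_mor u) = fun_map H (loc_mor u) • η x) ->
  forall (x y : HoLoc A) (p : x ⇒ y), η y • fun_map G p = fun_map H p • η x.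
Proof.
move=> nat; apply: Loc_natural => x y p.
by case: (loc_mor_surj p) => u ->; apply: nat.
Qed.

Section Lift.
Variables (L : Category) (T : A -> L) (M : forall x y : A, hom x y -> T x ⇒ T y)
  (M_id : forall x, M (id1 x) = idm (T x))
  (M_cmp : forall x y z (v : hom y z) (u : hom x y), M (v ∘ u) = M v • M u)
  (M_cell : forall x y (u v : hom x y), u ⇒ v -> M u = M v)
  (M_marked : forall x y (u : hom x y), marked u -> is_iso (M u)).

Lemma lift_rel (x y : A) (u v : hom x y) :
  clos_refl_sym_trans _ (@cell_rel A x y) u v -> M u = M v.
Proof. by elim=> {u v} [u v [/M_cell]|//|u v _ ->|u v w _ -> _ ->]. Qed.

Program Definition Ho_lift : Functor (Ho A) L :=
  {| fun_ob := T : Ho A -> L; fun_map := fun x y p => M (repr p) |}.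
Next Obligation. by rewrite -M_id; apply: lift_rel (repr_cls _ _). Qed.
Next Obligation. by rewrite -M_cmp; apply: lift_rel (repr_cls _ _). Qed.

Lemma Ho_lift_marked (x y : Ho A) (p : x ⇒ y) : ho_marked p -> is_iso (fun_map Ho_lift p).
Proof.
by move=> [u [mu ->]]; rewrite /= (lift_rel (repr_cls _ u)); apply: M_marked.
Qed.

Definition HoLoc_lift : Functor (HoLoc A) L := Loc_lift Ho_lift_marked.

Lemma HoLoc_liftE (x y : A) (u : hom x y) : fun_map HoLoc_lift (loc_mor u) = M u.
Proof. by rewrite /HoLoc_lift Loc_liftE /=; apply: lift_rel (repr_cls _ u). Qed.

End Lift.
End HoLocTheory.

Lemma HoLoc_mapE (A B : MarkedTwoCat) (F : MarkedFunctor A B) (x y : A) (u : hom x y) :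
  fun_map (HoLoc_map F) (loc_mor u) = loc_mor (fhom F u).
Proof.
rewrite /loc_mor /=; transitivity (loc_cls (lt_map (@Ho_map_marked A B F)
  (lt_mor (@ho_marked A) (ho_cls u)))).
  by apply: cls_eq; apply: (lt_map_rel (F := Ho_map F)); apply: repr_cls.
congr (loc_cls (lt_mor _ _)); apply: cls_eq; apply: clos_map (repr_cls _ _) => v v' [α].
apply: rst_step; exact: (inhabits (fcell F α)).
Qed.

(** * Morphisms of the localized slices *)

Section SliceCalculus.
Variables (C D : MarkedTwoCat) (f : MarkedFunctor C D).

Definition sob (d : D) (c : C) (h : hom d (f c)) : HoLoc (Slice f d) := Build_SliceOb f c h.

Definition smap (d : D) (c c' : C) (h : hom d (f c)) (k : hom d (f c')) (u : hom c c')
  (β : fhom f u ∘ h ⇒ k) : sob h ⇒ sob k :=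
  loc_mor (A := Slice f d)
    (@Build_SliceMor C D f d (Build_SliceOb f c h) (Build_SliceOb f c' k) u β).

Lemma smap_ext (d : D) (c c' : C) (h : hom d (f c)) (k : hom d (f c')) (u v : hom c c')
  (β : fhom f u ∘ h ⇒ k) (γ : fhom f v ∘ h ⇒ k) : u = v -> β ≈ γ -> smap β = smap γ.
Proof. by move=> e; destruct e => /heq_eq ->. Qed.

(** [ν] itself is a 2-cell of the slice between the two morphisms. Such pairs generate all
    identifications that the passage to connected components imposes. *)
Lemma smap_cell (d : D) (c c' : C) (h : hom d (f c)) (k : hom d (f c')) (u v : hom c c')
  (ν : u ⇒ v) (β : fhom f v ∘ h ⇒ k) : smap (β • (fcell f ν ▹ h)) = smap β.
Proof.
rewrite /smap; set s := Build_SliceMor _; set t := Build_SliceMor _.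
have σ : SliceCell s t by exists ν.
exact: (loc_mor_cell (A := Slice f d) (u := s) (v := t) σ).
Qed.

Lemma smap_cmp (d : D) (c c' c'' : C) (h : hom d (f c)) (k : hom d (f c'))
  (l : hom d (f c'')) (v : hom c' c'') (u : hom c c') (γ : fhom f v ∘ k ⇒ l)
  (β : fhom f u ∘ h ⇒ k) :
  smap γ • smap β = smap (γ • (fhom f v ◃ β) • eqcell (slice_comp_eq v u h)).
Proof. by rewrite /smap loc_mor_cmp. Qed.

(** The morphism over the identity of [c] given by a 2-cell of [D]. These carry the action of
    the 2-cells of [D] on the slices. *)
Definition vert (d : D) (c : C) (h h' : hom d (f c)) (κ : h ⇒ h') : sob h ⇒ sob h' :=
  smap (u := id1 c) (κ • eqcell (slice_id_eq (f := f) (Build_SliceOb f c h))).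

Lemma vert_id (d : D) (c : C) (h : hom d (f c)) : vert (idm h) = idm (sob h).
Proof. by rewrite /vert cmp_idl. Qed.

Lemma smap_vert (d : D) (c c' : C) (h h' : hom d (f c)) (k : hom d (f c')) (u : hom c c')
  (β : fhom f u ∘ h' ⇒ k) (κ : h ⇒ h') : smap β • vert κ = smap (β • (fhom f u ◃ κ)).
Proof.
rewrite /vert smap_cmp; apply: smap_ext; first exact: comp1_idr.
apply: heq_eqr; apply: heq_cmp; first exact: heq_refl.
rewrite whiskl_cmp eqcell_whiskl; apply: heq_eqr; exact: heq_refl.
Qed.

Lemma vert_smap (d : D) (c c' : C) (h : hom d (f c)) (k k' : hom d (f c')) (u : hom c c')
  (β : fhom f u ∘ h ⇒ k) (κ : k ⇒ k') : vert κ • smap β = smap (κ • β).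
Proof.
rewrite /vert smap_cmp; apply: smap_ext; first exact: comp1_idl.
apply: heq_eqr; apply: heq_cmp; first by apply: heq_eqr; apply: heq_refl.
by apply: heq_unitl; rewrite fhom_id.
Qed.

Lemma vert_cmp (d : D) (c : C) (h h' h'' : hom d (f c)) (κ' : h' ⇒ h'') (κ : h ⇒ h') :
  vert κ' • vert κ = vert (κ' • κ).
Proof. by rewrite {2}/vert vert_smap cmp_assoc. Qed.

(** The functor written [w^*] in the literature. *)
Definition pull (b d : D) (w : hom b d) : Functor (HoLoc (Slice f d)) (HoLoc (Slice f b)) :=
  HoLoc_map (precomp f w).

Lemma pull_smap (b d : D) (w : hom b d) (c c' : C) (h : hom d (f c)) (k : hom d (f c'))
  (u : hom c c') (β : fhom f u ∘ h ⇒ k) :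
  fun_map (pull w) (smap β) =
  smap (h := h ∘ w) (k := k ∘ w) ((β ▹ w) • eqcell (comp1_assoc (fhom f u) h w)).
Proof. by rewrite /pull HoLoc_mapE. Qed.

Lemma pull_vert (b d : D) (w : hom b d) (c : C) (h h' : hom d (f c)) (κ : h ⇒ h') :
  fun_map (pull w) (vert κ) = vert (κ ▹ w).
Proof.
rewrite /vert pull_smap; apply: smap_ext => //.
apply: heq_eqr; rewrite whiskr_cmp eqcell_whiskr.
apply: heq_eqr; apply: heq_sym; apply: heq_eqr; exact: heq_refl.
Qed.

Lemma slice_natural (d : D) (L : Category) (G H : Functor (HoLoc (Slice f d)) L)
  (η : forall x : HoLoc (Slice f d), G x ⇒ H x) :
  (forall (c c' : C) (h : hom d (f c)) (k : hom d (f c')) (u : hom c c')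
     (β : fhom f u ∘ h ⇒ k),
     η (sob k) • fun_map G (smap β) = fun_map H (smap β) • η (sob h)) ->
  forall (x y : HoLoc (Slice f d)) (p : x ⇒ y), η y • fun_map G p = fun_map H p • η x.
Proof.
move=> nat; apply: (HoLoc_natural (A := Slice f d)) => [[c h] [c' k] [u β]].
exact: nat.
Qed.

End SliceCalculus.
Arguments sob {C D} f {d c} h.
Arguments smap {C D} f {d c c' h k u} β.
Arguments vert {C D} f {d c h h'} κ.

(** * Cocones as natural transformations *)

Lemma compF_map (K L M : Category) (G : Functor L M) (F : Functor K L) (x y : K) (p : x ⇒ y) :
  fun_map (compF G F) p = fun_map G (fun_map F p).
Proof. by []. Qed.

Lemma whiskl_iso (A : TwoCat) (a b c : A) (g : hom b c) (k k' : hom a b) (α : k ⇒ k') :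
  is_iso α -> is_iso (g ◃ α).
Proof.
by move=> [α' [h h']]; exists (g ◃ α'); rewrite -!whiskl_cmp h h' !hcomp_id.
Qed.

Lemma whiskr_iso (A : TwoCat) (a b c : A) (g g' : hom b c) (k : hom a b) (β : g ⇒ g') :
  is_iso β -> is_iso (β ▹ k).
Proof.
by move=> [β' [h h']]; exists (β' ▹ k); rewrite -!whiskr_cmp h h' !hcomp_id.
Qed.

Lemma fcell_iso (A B : TwoCat) (F : TwoFunctor A B) (a b : A) (u v : hom a b) (α : u ⇒ v) :
  is_iso α -> is_iso (fcell F α).
Proof.
by move=> [α' [h h']]; exists (fcell F α'); rewrite -!fcell_cmp h h' !fcell_id.
Qed.

Lemma heq_whiskr_fhom_comp (A B : TwoCat) (F : TwoFunctor A B) (x y z : A) (a : B)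
  (v : hom y z) (u : hom x y) (l l' : hom (F z) a) (θ : l ⇒ l') :
  θ ▹ fhom F (v ∘ u) ≈ (θ ▹ fhom F v) ▹ fhom F u.
Proof.
apply: (heq_trans (g := θ ⋆ (idm (fhom F v) ⋆ idm (fhom F u)))); last exact: heq_assoc.
apply: heq_hcomp; first exact: heq_refl.
by rewrite hcomp_id fhom_comp; apply: heq_refl.
Qed.

Lemma heq_whiskl_fcell_whiskr (A B : TwoCat) (F : TwoFunctor A B) (x y z : A) (a : B)
  (l : hom (F z) a) (v v' : hom y z) (β : v ⇒ v') (u : hom x y) :
  l ◃ fcell F (β ▹ u) ≈ (l ◃ fcell F β) ▹ fhom F u.
Proof.
apply: (heq_trans (g := l ◃ (fcell F β ▹ fhom F u))); last exact: heq_assoc.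
by apply: heq_whiskl; rewrite -fcell_id; apply: heq_fcell_hcomp.
Qed.

Lemma heq_whiskl_fcell_whiskl (A B : TwoCat) (F : TwoFunctor A B) (x y z : A) (a : B)
  (l : hom (F z) a) (v : hom y z) (u u' : hom x y) (β : u ⇒ u') :
  l ◃ fcell F (v ◃ β) ≈ (l ∘ fhom F v) ◃ fcell F β.
Proof.
apply: (heq_trans (g := l ◃ (fhom F v ◃ fcell F β))).
  by apply: heq_whiskl; rewrite -fcell_id; apply: heq_fcell_hcomp.
by rewrite -hcomp_id; apply: heq_assoc.
Qed.

Section Yoneda.
Variables (C D : MarkedTwoCat) (f : MarkedFunctor C D) (A : TwoCat) (F : TwoFunctor D A) (a : A).

Section Functor.
Variable γ : Cocone (B := C) (comp2F F f) a.

Definition yon_ob (d : D) (x : SliceOb f d) : hom (F d) a :=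
  (leg γ (pt x) : hom (F (f (pt x))) a) ∘ fhom F (arr x).

(** A morphism [(u, β)] goes to [leg c ∘ F h ⇒ leg c' ∘ F (f u) ∘ F h ⇒ leg c' ∘ F k], by the
    cell of [γ] at [u] followed by [F β]. *)
Definition yon_mor (d : D) (c c' : C) (h : hom d (f c)) (k : hom d (f c')) (u : hom c c')
  (β : fhom f u ∘ h ⇒ k) :
  yon_ob (Build_SliceOb f c h) ⇒ yon_ob (Build_SliceOb f c' k) :=
  ((leg γ c' : hom (F (f c')) a) ◃ fcell F β)
  • eqcell (cocone_comp_eq (F := F) (leg γ c' : hom (F (f c')) a) (fhom f u) h)
  • (legcell γ u ▹ fhom F h).

Lemma yon_mor_id (d : D) (c : C) (h : hom d (f c)) p :
  yon_mor (h := h) (k := h) (u := id1 c) (eqcell p) = idm _.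
Proof.
rewrite /yon_mor fcell_eqcell eqcell_whiskl legcell_id eqcell_whiskr !eqcell_cmp.
exact: eqcell_id.
Qed.

Lemma yon_mor_cell (d : D) (c c' : C) (h : hom d (f c)) (k : hom d (f c')) (u v : hom c c')
  (ν : u ⇒ v) (β : fhom f v ∘ h ⇒ k) : yon_mor (β • (fcell f ν ▹ h)) = yon_mor β.
Proof.
rewrite /yon_mor fcell_cmp whiskl_cmp -(legcell_nat γ ν) whiskr_cmp -!cmp_assoc.
congr (_ • _); rewrite !cmp_assoc; congr (_ • _).
apply: heq_eq; apply: heq_eqr; apply: heq_sym; apply: heq_eql; apply: heq_sym.
exact: heq_whiskl_fcell_whiskr.
Qed.

(** The two sides differ by an interchange of [F β] with the cell of [γ] at [v]. *)
Lemma yon_mor_cmp (d : D) (c c' c'' : C) (h : hom d (f c)) (k : hom d (f c'))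
  (l : hom d (f c'')) (v : hom c' c'') (u : hom c c') (δ : fhom f v ∘ k ⇒ l)
  (β : fhom f u ∘ h ⇒ k) p :
  yon_mor (u := v ∘ u) (δ • (fhom f v ◃ β) • eqcell p) = yon_mor δ • yon_mor β.
Proof.
rewrite /yon_mor !fcell_cmp !whiskl_cmp fcell_eqcell eqcell_whiskl.
rewrite legcell_comp !whiskr_cmp !eqcell_whiskr -!cmp_assoc.
congr (_ • _); rewrite !cmp_assoc.
have e : (legcell γ v ▹ fhom F k) • ((leg γ c' : hom (F (f c')) a) ◃ fcell F β) =
   (((leg γ c'' : hom (F (f c'')) a) ∘ fhom F (fhom f v)) ◃ fcell F β)
   • (legcell γ v ▹ fhom F (fhom f u ∘ h)).
  by rewrite -!interchange !cmp_idl !cmp_idr.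
rewrite -(cmp_assoc _ (legcell γ v ▹ fhom F k)) e.
apply: heq_eq; apply: heq_cmp; last exact: heq_refl.
apply: heq_sym; apply: heq_eqr; apply: heq_sym; rewrite cmp_assoc.
apply: heq_cmp; last first.
  by apply: heq_sym; apply: heq_whiskr_fhom_comp.
rewrite -!cmp_assoc !eqcell_cmp; apply: heq_eqr; apply: heq_sym; apply: heq_eql.
apply: heq_sym; exact: heq_whiskl_fcell_whiskl.
Qed.

Lemma yon_mor_iso (d : D) (c c' : C) (h : hom d (f c)) (k : hom d (f c')) (u : hom c c')
  (β : fhom f u ∘ h ⇒ k) : marked u -> is_iso β -> is_iso (yon_mor β).
Proof.
move=> mu iβ; apply: is_iso_cmp; last by apply: whiskr_iso; exact: (legcell_marked γ mu).
by apply: is_iso_cmp; [apply: whiskl_iso; apply: fcell_iso | apply: eqcell_iso].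
Qed.

(** The component at [d] of the 2-natural transformation [ho(C_{d↑})[W^-1] ⇒ A(F d, a)]
    corresponding to [γ]; on objects it sends [(c, h)] to [leg γ c ∘ F h]. *)
Program Definition yon (d : D) : Functor (HoLoc (Slice f d)) (hom (F d) a) :=
  HoLoc_lift (A := Slice f d) (T := @yon_ob d)
    (M := fun x y s => yon_mor (u := smor s) (scell s)) _ _ _ _.
Next Obligation. exact: yon_mor_id. Qed.
Next Obligation. exact: yon_mor_cmp. Qed.
Next Obligation.
case: X => ν /= <-; exact: yon_mor_cell.
Qed.
Next Obligation. exact: yon_mor_iso. Qed.

Lemma yonE (d : D) (c c' : C) (h : hom d (f c)) (k : hom d (f c')) (u : hom c c')
  (β : fhom f u ∘ h ⇒ k) : fun_map (yon d) (smap f β) = yon_mor β.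
Proof. by rewrite /yon /smap HoLoc_liftE. Qed.

Lemma yon_vert (d : D) (c : C) (h h' : hom d (f c)) (κ : h ⇒ h') :
  fun_map (yon d) (vert f κ) = (leg γ c : hom (F (f c)) a) ◃ fcell F κ.
Proof.
rewrite /vert yonE /yon_mor legcell_id eqcell_whiskr -!cmp_assoc eqcell_cmp.
apply: heq_eq; rewrite fcell_cmp fcell_eqcell whiskl_cmp eqcell_whiskl.
rewrite -cmp_assoc eqcell_cmp; apply: heq_eqr; exact: heq_refl.
Qed.

End Functor.

Lemma yon_mor_natural (γ δ : Cocone (B := C) (comp2F F f) a) (θ : CoconeHom γ δ) (d : D)
  (c c' : C) (h : hom d (f c)) (k : hom d (f c')) (u : hom c c') (β : fhom f u ∘ h ⇒ k) :
  ((proj1_sig θ c' : (leg γ c' : hom (F (f c')) a) ⇒ leg δ c') ▹ fhom F k) • yon_mor γ β =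
  yon_mor δ β • ((proj1_sig θ c : (leg γ c : hom (F (f c)) a) ⇒ leg δ c) ▹ fhom F h).
Proof.
case: θ => θ nat /=; rewrite /yon_mor -[RHS]cmp_assoc -whiskr_cmp nat whiskr_cmp !cmp_assoc.
congr (_ • _).
have e : ((θ c' : (leg γ c' : hom (F (f c')) a) ⇒ leg δ c') ▹ fhom F k) •
   ((leg γ c' : hom (F (f c')) a) ◃ fcell F β) = ((leg δ c' : hom (F (f c')) a) ◃ fcell F β)
   • ((θ c' : (leg γ c' : hom (F (f c')) a) ⇒ leg δ c') ▹ fhom F (fhom f u ∘ h)).
  by rewrite -!interchange !cmp_idl !cmp_idr.
rewrite e -!cmp_assoc; congr (_ • _).
apply: heq_eq; apply: heq_eqr; apply: heq_sym; apply: heq_eql; apply: heq_sym.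
exact: heq_whiskr_fhom_comp.
Qed.

(** A morphism of cocones induces a modification. *)
Lemma yon_natural (γ δ : Cocone (B := C) (comp2F F f) a) (θ : CoconeHom γ δ) (d : D)
  (x y : HoLoc (Slice f d)) (p : x ⇒ y) :
  ((proj1_sig θ (pt y) : (leg γ (pt y) : hom (F (f (pt y))) a) ⇒ leg δ (pt y)) ▹ fhom F (arr y))
    • fun_map (yon γ d) p =
  fun_map (yon δ d) p
  • ((proj1_sig θ (pt x) : (leg γ (pt x) : hom (F (f (pt x))) a) ⇒ leg δ (pt x))
       ▹ fhom F (arr x)).
Proof.
move: x y p; apply: (slice_natural (G := yon γ d) (H := yon δ d)
  (η := fun x : HoLoc (Slice f d) => proj1_sig θ (pt x) ▹ fhom F (arr x))) => c c' h k u β.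
by rewrite !yonE; apply: yon_mor_natural.
Qed.

Program Definition rwhisk (x y : A) (k : hom x y) : Functor (hom y a) (hom x a) :=
  {| fun_ob := fun l => l ∘ k; fun_map := fun l l' α => α ▹ k |}.
Next Obligation. exact: hcomp_id. Qed.
Next Obligation. exact: whiskr_cmp. Qed.

(** Strict 2-naturality of [yon γ] in [d]. *)
Lemma yon_pull (γ : Cocone (B := C) (comp2F F f) a) (b d : D) (w : hom b d)
  (x y : HoLoc (Slice f d)) (p : x ⇒ y) :
  fun_map (yon γ b) (fun_map (pull f w) p) ≈ fun_map (yon γ d) p ▹ fhom F w.
Proof.
have e (z : SliceOb f d) : (yon γ d z) ∘ fhom F w = yon γ b (pull f w z).
  exact: (cocone_comp_eq (F := F) (leg γ (pt z) : hom (F (f (pt z))) a) (arr z) w).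
apply: heq_sym; exists (e x), (e y); move: x y p.
apply: (slice_natural (G := compF (rwhisk (fhom F w)) (yon γ d))
   (H := compF (yon γ b) (pull f w)) (η := fun z => eqcell (e z))) => c c' h k u β.
rewrite !compF_map pull_smap !yonE /yon_mor /=.
apply: heq_eq; apply: heq_eql; apply: heq_sym; apply: heq_eqr; apply: heq_sym.
rewrite !whiskr_cmp !eqcell_whiskr !fcell_cmp whiskl_cmp fcell_eqcell eqcell_whiskl.
rewrite -[X in _ ≈ X • _]cmp_assoc eqcell_cmp.
apply: heq_cmp; last by apply: heq_sym; apply: heq_whiskr_fhom_comp.
apply: heq_eqr; apply: heq_sym; apply: heq_eqr.
exact: heq_whiskl_fcell_whiskr.
Qed.

End Yoneda.

Section Unit.
Variables (C D : MarkedTwoCat) (f : MarkedFunctor C D).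

Lemma unit_eq (c c' : C) (u : hom c c') :
  fhom f u ∘ id1 (f c) = id1 (f c') ∘ fhom f u.
Proof. by rewrite comp1_idl comp1_idr. Qed.

(** The cells of the universal cocone, whose leg at [c] is [(c, id)]. *)
Definition unit_map (c c' : C) (u : hom c c') :
  sob f (id1 (f c)) ⇒ pull f (fhom f u) (sob f (id1 (f c'))) :=
  smap f (h := id1 (f c)) (k := id1 (f c') ∘ fhom f u) (eqcell (unit_eq u)).

(** The cocone [γ] is recovered from the transformation [yon γ] by evaluating it at the
    universal cocone, as in the Yoneda lemma. *)
Lemma yon_unit (A : TwoCat) (F : TwoFunctor D A) (a : A)
  (γ : Cocone (B := C) (comp2F F f) a) (c c' : C) (u : hom c c') :
  fun_map (yon γ (f c)) (unit_map u) ≈ legcell γ u.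
Proof.
rewrite /unit_map yonE /yon_mor fcell_eqcell eqcell_whiskl eqcell_cmp.
apply: heq_eql; apply: heq_unitr; exact: fhom_id.
Qed.

Lemma unit_map_iso (c c' : C) (u : hom c c') : marked u -> is_iso (unit_map u).
Proof.
move=> mu; apply: (loc_mor_marked (A := Slice f (f c))); split=> //; exact: eqcell_iso.
Qed.
End Unit.

Section Comparison.
Variables (C D : MarkedTwoCat) (f : MarkedFunctor C D) (d : D).

Definition push_mor (x y : SliceOb f d) (s : SliceMor x y) :
  sob (idMF D) (arr x) ⇒ sob (idMF D) (arr y) :=
  smap (idMF D) (u := fhom f (smor s)) (scell s).

Lemma push_mor_id (x : SliceOb f d) :
  push_mor (slice_id x) = idm (sob (idMF D) (arr x)).
Proof.
rewrite -vert_id; apply: smap_ext; first exact: fhom_id.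
by apply: heq_sym; rewrite cmp_idl; apply: heq_eqcells; rewrite /= fhom_id.
Qed.

Lemma push_mor_cmp (x y z : SliceOb f d) (t : SliceMor y z) (s : SliceMor x y) :
  push_mor (slice_comp t s) = push_mor t • push_mor s.
Proof.
rewrite smap_cmp; apply: smap_ext; first exact: fhom_comp.
apply: heq_eqr; apply: heq_sym; apply: heq_eqr; exact: heq_refl.
Qed.

Lemma push_mor_cell (x y : SliceOb f d) (s t : SliceMor x y) (ν : SliceCell s t) :
  push_mor s = push_mor t.
Proof.
case: ν => ν e; rewrite /push_mor -e; exact: (smap_cell (f := idMF D) (fcell f ν)).
Qed.

Lemma push_mor_marked (x y : Slice f d) (s : hom x y) : marked s -> is_iso (push_mor s).
Proof.
move=> [ms iso_s]; apply: (loc_mor_marked (A := Slice (idMF D) d)).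
by split=> //; exact: (fhom_marked f ms).
Qed.

(** The comparison functor [ho(C_{d↑})[W^-1] → ho(D_{d↑})[W^-1], (c, h) ↦ (f c, h)]. *)
Definition push : Functor (HoLoc (Slice f d)) (HoLoc (Slice (idMF D) d)) :=
  HoLoc_lift (A := Slice f d) (M := push_mor)
    push_mor_id push_mor_cmp push_mor_cell push_mor_marked.

Lemma push_smap (c c' : C) (h : hom d (f c)) (k : hom d (f c'))
  (u : hom c c') (β : fhom f u ∘ h ⇒ k) :
  fun_map push (smap f β) = smap (idMF D) (u := fhom f u) β.
Proof. by rewrite /push /smap HoLoc_liftE. Qed.

Lemma push_vert (c : C) (h h' : hom d (f c)) (κ : h ⇒ h') :
  fun_map push (vert f κ) = vert (idMF D) κ.
Proof.
rewrite /vert push_smap; apply: smap_ext; first exact: fhom_id.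
apply: heq_eqr; apply: heq_sym; apply: heq_eqr; exact: heq_refl.
Qed.

(** Restricting a cocone along [f] amounts to restricting its transformation along [push]. *)
Lemma yon_push (A : TwoCat) (F : TwoFunctor D A) (a : A) (α : Cocone F a)
  (x y : HoLoc (Slice f d)) (p : x ⇒ y) :
  fun_map (yon (f := f) (restr_ob f α) d) p =
  fun_map (yon (f := idMF D) (restr_ob (idMF D) α) d) (fun_map push p).
Proof.
have := slice_natural (G := yon (restr_ob f α) d)
  (H := compF (yon (f := idMF D) (restr_ob (idMF D) α) d) push)
  (η := fun z => idm (leg α (f (pt z)) ∘ fhom F (arr z))) _ p.
rewrite !compF_map cmp_idl cmp_idr; apply=> c c' h k u β.
by rewrite !compF_map cmp_idl cmp_idr push_smap !yonE.
Qed.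

End Comparison.
Arguments push {C D} f d.

Lemma push_pull (C D : MarkedTwoCat) (f : MarkedFunctor C D) (b d : D) (w : hom b d)
  (x y : HoLoc (Slice f d)) (p : x ⇒ y) :
  fun_map (push f b) (fun_map (pull f w) p) =
  fun_map (pull (idMF D) w) (fun_map (push f d) p).
Proof.
have := slice_natural (G := compF (push f b) (pull f w))
  (H := compF (pull (idMF D) w) (push f d))
  (η := fun z => idm (sob (idMF D) (arr z ∘ w))) _ p.
rewrite !compF_map cmp_idl cmp_idr; apply=> c c' h k u β.
by rewrite !compF_map cmp_idl cmp_idr push_smap !pull_smap push_smap.
Qed.

(** * Pullbacks of slice objects and the initial object of [D_{d↑}] *)

Program Definition constF (K L : Category) (l : L) : Functor K L :=
  {| fun_ob := fun _ => l; fun_map := fun _ _ _ => idm l |}.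
Next Obligation. by rewrite cmp_idl. Qed.

Section PullObjects.
Variables (C D : MarkedTwoCat) (f : MarkedFunctor C D).

Lemma pull_id_ob (d : D) (x : HoLoc (Slice f d)) : x = pull f (id1 d) x.
Proof. case: x => c h; congr (Build_SliceOb _ _ _); exact: (eq_sym (comp1_idr _)). Qed.

Lemma pull_comp_ob (b d e : D) (v : hom d e) (u : hom b d) (x : HoLoc (Slice f e)) :
  pull f u (pull f v x) = pull f (v ∘ u) x.
Proof. case: x => c h; congr (Build_SliceOb _ _ _); exact: (eq_sym (comp1_assoc _ _ _)). Qed.

(** The action of a 2-cell of [D] on the slices. *)
Definition pull_cell (b d : D) (u w : hom b d) (β : u ⇒ w) (x : HoLoc (Slice f d)) :
  pull f u x ⇒ pull f w x := vert f (arr x ◃ β).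

Lemma yon_pull_ob (A : TwoCat) (F : TwoFunctor D A) (a : A)
  (γ : Cocone (B := C) (comp2F F f) a) (b d : D) (w : hom b d) (x : HoLoc (Slice f d)) :
  yon γ b (pull f w x) = yon γ d x ∘ fhom F w.
Proof.
exact: (eq_sym (cocone_comp_eq (F := F) (leg γ (pt x) : hom (F (f (pt x))) a) (arr x) w)).
Qed.

Lemma yon_pull_cell (A : TwoCat) (F : TwoFunctor D A) (a : A)
  (γ : Cocone (B := C) (comp2F F f) a) (b d : D) (u w : hom b d) (β : u ⇒ w)
  (x : HoLoc (Slice f d)) :
  fun_map (yon γ b) (pull_cell β x) ≈ yon γ d x ◃ fcell F β.
Proof. rewrite yon_vert; exact: heq_whiskl_fcell_whiskl. Qed.

End PullObjects.

(** There is one canonical map [id ⇒ (e, h)], given by [u = h], and it is natural in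
    [(e, h)] because the 2-cell of a slice morphism is itself a 2-cell of the slice.
    Naturality extends to the localization, and at a map out of [id] it says that this map
    is the canonical one. *)
Lemma id_initial (D : MarkedTwoCat) (d : D) : Initial (sob (idMF D) (id1 d)).
Proof.
pose t (x : SliceOb (idMF D) d) :=
  match x as y return @Hom (HoLoc (Slice (idMF D) d)) (sob (idMF D) (id1 d)) y with
  | Build_SliceOb _ c h => smap (idMF D) (u := h) (k := h) (eqcell (comp1_idr h))
  end.
have tE : forall (c : D) (h : hom d c),
    t (sob (idMF D) h) = smap (idMF D) (k := h) (u := h) (eqcell (comp1_idr h)) by [].
have nat : forall (x y : HoLoc (Slice (idMF D) d)) (p : x ⇒ y), t y = p • t x.
  move=> x y p; rewrite -[t y]cmp_idr.
  apply: (slice_natural (G := constF _ (sob (idMF D) (id1 d)))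
    (H := idF (HoLoc (Slice (idMF D) d))) (η := t)) => c c' h k u β.
  change (t (sob _ k) • idm _ = smap (idMF D) β • t (sob _ h)).
  rewrite cmp_idr !tE smap_cmp -(smap_cell (f := idMF D) β).
  apply: smap_ext => //; apply: heq_eql; apply: heq_sym; apply: heq_eqr.
  rewrite eqcell_whiskl; apply: heq_eqr; apply: heq_sym; exact: heq_unitr.
have t_id : t (sob (idMF D) (id1 d)) = idm _.
  rewrite tE -vert_id; apply: smap_ext => //.
  by rewrite cmp_idl; apply: heq_eqcells.
by move=> x; exists (t x) => m; rewrite (nat _ _ m) t_id cmp_idr.
Qed.

Arguments id_initial {D} d _.

(** Inverting the components of a modification gives a modification again. *)
Lemma CoconeHom_iso (B : MarkedTwoCat) (A : TwoCat) (F : TwoFunctor B A) (a : A)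
  (α β : CoconeCat F a) (θ : α ⇒ β) : (forall b, is_iso (proj1_sig θ b)) -> is_iso θ.
Proof.
case: θ => θ nat /= iso.
have nat' : forall (b b' : B) (u : hom b b'), legcell α u • iso_inv (iso b) =
    (iso_inv (iso b') ▹ fhom F u) • legcell β u.
  move=> b b' u; apply: (iso_mono (whiskr_iso (fhom F u) (iso b'))).
  rewrite !cmp_assoc -nat -whiskr_cmp iso_invr hcomp_id cmp_idl.
  by rewrite -cmp_assoc iso_invr cmp_idr.
exists (exist _ (fun b => iso_inv (iso b)) nat').
by split; apply: CoconeHom_eq => b /=; rewrite ?iso_invl ?iso_invr.
Qed.

(** * The conditions imply cofinality *)

(** [g] is a choice of the objects in the first condition; [idC] is the second condition for
    the identities of the objects [f c]. *)
Section Sufficiency.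
Variables (C D : MarkedTwoCat) (f : MarkedFunctor C D).
Variable g : forall d : D, HoLoc (Slice f d).
Hypothesis gC : forall d, Initial (g d).
Hypothesis gD : forall d, Initial (push f d (g d)).
Hypothesis idC : forall c, Initial (sob f (id1 (f c))).
Hypothesis pullC : forall (b d : D) (w : hom b d), marked w -> PreservesInitial (pull f w).
Variables (A : TwoCat) (F : TwoFunctor D A) (a : A).

Arguments gC : clear implicits.
Arguments gD : clear implicits.
Arguments idC : clear implicits.

Section Extension.
Variable γ : Cocone (B := C) (comp2F F f) a.

(** The extension of a cocone has leg [yon γ (g d)] at [d]. Its cells are the images of the
    unique maps [g d ⇒ u^* (g d')], so each law of a cocone reduces to an equality of two
    maps out of the initial object [g d]. *)
Definition ext_map (d d' : D) (u : hom d d') : g d ⇒ pull f u (g d') :=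
  initial_map (gC d) (pull f u (g d')).

Definition ext_cell (d d' : D) (u : hom d d') :
  yon γ d (g d) ⇒ yon γ d' (g d') ∘ fhom F u :=
  eqcell (yon_pull_ob γ u (g d')) • fun_map (yon γ d) (ext_map u).

(** Over a marked [u] the map [g d ⇒ u^* (g d')] is an isomorphism, since pulling back along
    [u] preserves initial objects. *)
Lemma ext_cell_marked (d d' : D) (u : hom d d') : marked u -> is_iso (ext_cell u).
Proof.
move=> mu; apply: is_iso_cmp; first exact: eqcell_iso.
by apply: fun_map_iso; apply: Initial_is_iso => //; apply: pullC.
Qed.

Lemma ext_cell_id (d : D) : ext_cell (id1 d) = eqcell (cocone_id_eq (F := F) (yon γ d (g d))).
Proof.
rewrite /ext_cell (Initial_eq (ext_map (id1 d)) (eqcell (pull_id_ob (g d))) (gC d)).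
rewrite fun_map_eqcell eqcell_cmp; exact: eqcell_irr.
Qed.

Lemma ext_cell_comp (d d' d'' : D) (v : hom d' d'') (u : hom d d') :
  ext_cell (v ∘ u) = eqcell (cocone_comp_eq (F := F) (yon γ d'' (g d'')) v u)
    • ((ext_cell v ▹ fhom F u) • ext_cell u).
Proof.
rewrite {1}/ext_cell (Initial_eq (ext_map (v ∘ u)) (eqcell (pull_comp_ob v u (g d''))
  • (fun_map (pull f u) (ext_map v) • ext_map u)) (gC d)).
rewrite !fun_map_cmp fun_map_eqcell.
apply: heq_eq; apply: heq_eql; apply: heq_eql; apply: heq_sym; apply: heq_eql.
apply: heq_cmp; last by apply: heq_eql; apply: heq_refl.
rewrite whiskr_cmp eqcell_whiskr; apply: heq_eql.
by apply: heq_sym; apply: yon_pull.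
Qed.

Lemma ext_cell_nat (d d' : D) (u w : hom d d') (β : u ⇒ w) :
  (yon γ d' (g d') ◃ fcell F β) • ext_cell u = ext_cell w.
Proof.
rewrite {2}/ext_cell (Initial_eq (ext_map w) (pull_cell β (g d') • ext_map u) (gC d)).
rewrite fun_map_cmp; apply: heq_eq; apply: heq_sym; apply: heq_eql.
apply: heq_cmp; first exact: yon_pull_cell.
by apply: heq_sym; apply: heq_eql; apply: heq_refl.
Qed.

Definition ext : Cocone F a :=
  Build_Cocone (leg := fun d => yon γ d (g d)) ext_cell_marked ext_cell_id ext_cell_comp
    ext_cell_nat.

Lemma leg_id_eq (c : C) : yon γ (f c) (sob f (id1 (f c))) = leg γ c.
Proof. by rewrite /= /yon_ob /= fhom_id comp1_idr. Qed.

(** Both [g (f c)] and the identity of [f c] are initial in the slice over [f c], and the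
    value of [yon γ] at the latter is the leg of [γ] at [c]. *)
Definition counit_cell (c : C) : leg (restr_ob f ext) c ⇒ leg γ c :=
  eqcell (leg_id_eq c) • fun_map (yon γ (f c)) (initial_map (gC (f c)) (sob f (id1 (f c)))).

Lemma counit_natural (c c' : C) (u : hom c c') :
  legcell γ u • counit_cell c =
  (counit_cell c' ▹ fhom (comp2F F f) u) • legcell (restr_ob f ext) u.
Proof.
have e := Initial_eq (unit_map f u • initial_map (gC (f c)) (sob f (id1 (f c))))
  (fun_map (pull f (fhom f u)) (initial_map (gC (f c')) (sob f (id1 (f c'))))
   • ext_map (fhom f u)) (gC (f c)).
have {}e := f_equal (fun p => fun_map (yon γ (f c)) p) e; rewrite !fun_map_cmp in e.
apply: heq_eq; apply: (heq_trans (heq_cmp (heq_sym (yon_unit γ u)) (heq_eql _ (heq_refl _)))).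
rewrite e; apply: heq_sym; apply: heq_cmp; last by apply: heq_eql; apply: heq_refl.
rewrite whiskr_cmp eqcell_whiskr; apply: heq_eql.
by apply: heq_sym; apply: yon_pull.
Qed.

Lemma restr_surjective : exists α : CoconeCat F a, Iso (restr f F a α) γ.
Proof.
exists ext; exists (exist _ counit_cell counit_natural); apply: CoconeHom_iso => c /=.
apply: is_iso_cmp; first exact: eqcell_iso.
by apply: fun_map_iso; apply: Initial_is_iso; [apply: gC | apply: idC].
Qed.

End Extension.

(** A morphism [ε] between restricted cocones has a component at every slice object
    [(c, h) : d → f c], by whiskering. The component at [d] itself must be the conjugate of the
    one at [g d] by the isomorphism [id ≅ g d] of initial objects of [D_{d↑}]. *)
Section Full.
Variables (α β : Cocone F a) (ε : CoconeHom (restr_ob f α) (restr_ob f β)).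
Let Y (δ : Cocone F a) (d : D) : Functor (HoLoc (Slice (idMF D) d)) (hom (F d) a) :=
  yon (f := idMF D) (restr_ob (idMF D) δ) d.

Definition to_g (d : D) : sob (idMF D) (id1 d) ⇒ push f d (g d) :=
  initial_map (id_initial d) (push f d (g d)).
Definition from_g (d : D) : push f d (g d) ⇒ sob (idMF D) (id1 d) :=
  initial_map (gD d) (sob (idMF D) (id1 d)).

Definition slice_component (d : D) (x : HoLoc (Slice f d)) :
  Y α d (push f d x) ⇒ Y β d (push f d x) :=
  (proj1_sig ε (pt x) : (leg α (f (pt x)) : hom (F (f (pt x))) a) ⇒ leg β (f (pt x)))
    ▹ fhom F (arr x).

Lemma slice_component_natural (d : D) (x y : HoLoc (Slice f d)) (p : x ⇒ y) :
  slice_component y • fun_map (Y α d) (fun_map (push f d) p) =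
  fun_map (Y β d) (fun_map (push f d) p) • slice_component x.
Proof. rewrite -!yon_push; exact: (yon_natural ε p). Qed.

Lemma slice_component_pull (b d : D) (w : hom b d) (x : HoLoc (Slice f d)) :
  slice_component (pull f w x) ≈ slice_component x ▹ fhom F w.
Proof. exact: heq_whiskr_fhom_comp. Qed.

Definition component_core (d : D) :
  Y α d (sob (idMF D) (id1 d)) ⇒ Y β d (sob (idMF D) (id1 d)) :=
  fun_map (Y β d) (from_g d) • (slice_component (g d) • fun_map (Y α d) (to_g d)).

Lemma yon_id_eq (δ : Cocone F a) (d : D) : Y δ d (sob (idMF D) (id1 d)) = leg δ d.
Proof. by rewrite /= /yon_ob /= fhom_id comp1_idr. Qed.

Definition full_component (d : D) : leg α d ⇒ leg β d :=
  eqcell (yon_id_eq β d) • (component_core d • eqcell (eq_sym (yon_id_eq α d))).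

Lemma full_componentE (d : D) : full_component d ≈ component_core d.
Proof. apply: heq_eql; apply: heq_eqr; exact: heq_refl. Qed.

(** Initiality in the two slices gives [u^* j' ∘ unit = push m ∘ j], for the isomorphisms
    [j : id ≅ g d] and [j' : id ≅ g d'] in [D_{d↑}] and [D_{d'↑}] and the map
    [m : g d ⇒ u^* (g d')] of [C_{d↑}]. Since [m] lives over [C], the components of [ε] are
    natural with respect to it. *)
Lemma full_component_natural (d d' : D) (u : hom d d') :
  legcell β u • full_component d = (full_component d' ▹ fhom F u) • legcell α u.
Proof.
pose U := unit_map (idMF D) u.
pose m := initial_map (gC d) (pull f u (g d')).
pose J := fun_map (pull (idMF D) u) (to_g d').
pose J' := fun_map (pull (idMF D) u) (from_g d').
have e1 : J • U = fun_map (push f d) m • to_g d := Initial_eq _ _ (id_initial d).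
have e2 : U • from_g d = J' • fun_map (push f d) m := Initial_eq _ _ (gD d).
have e : fun_map (Y β d) U • component_core d =
  fun_map (Y β d) J' • (slice_component (pull f u (g d')) • fun_map (Y α d) J)
    • fun_map (Y α d) U.
  rewrite -!cmp_assoc -fun_map_cmp e1 fun_map_cmp [slice_component _ • _]cmp_assoc.
  rewrite slice_component_natural /component_core !cmp_assoc; congr (_ • _ • _).
  by rewrite -!fun_map_cmp e2.
have hα : fun_map (Y α d) U ≈ legcell α u :=
  yon_unit (f := idMF D) (restr_ob (idMF D) α) u.
have hβ : fun_map (Y β d) U ≈ legcell β u :=
  yon_unit (f := idMF D) (restr_ob (idMF D) β) u.
apply: heq_eq; apply: (heq_trans (heq_cmp (heq_sym hβ) (full_componentE d))).
rewrite e; apply: heq_cmp hα.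
apply: heq_sym; apply: (heq_trans (heq_whiskr _ (full_componentE d'))).
rewrite !whiskr_cmp; apply: heq_sym; apply: heq_cmp; last apply: heq_cmp.
- exact: (yon_pull (f := idMF D)).
- exact: slice_component_pull.
- exact: (yon_pull (f := idMF D) (restr_ob (idMF D) α) u (to_g d')).
Qed.

(** For [d = f c] the isomorphism [id ≅ g (f c)] already exists over [C], where [ε] is natural. *)
Lemma full_component_restr (c : C) : full_component (f c) = proj1_sig ε c.
Proof.
pose k := initial_map (idC c) (g (f c)).
pose k' := initial_map (gC (f c)) (sob f (id1 (f c))).
have e : component_core (f c) = slice_component (sob f (id1 (f c))).
  transitivity (fun_map (Y β (f c)) (fun_map (push f (f c)) k')
    • (slice_component (g (f c)) • fun_map (Y α (f c)) (fun_map (push f (f c)) k))).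
    rewrite /component_core (Initial_eq (to_g _) (fun_map (push f (f c)) k) (id_initial _)).
    by rewrite (Initial_eq (from_g _) (fun_map (push f (f c)) k') (gD _)).
  rewrite slice_component_natural cmp_assoc -!fun_map_cmp.
  by rewrite (Initial_eq (k' • k) (idm _) (idC c)) !fun_map_id cmp_idl.
apply: heq_eq; apply: (heq_trans (full_componentE _)); rewrite e.
by apply: heq_unitr; apply: fhom_id.
Qed.

End Full.

Lemma restr_full (α β : CoconeCat F a) (ε : restr f F a α ⇒ restr f F a β) :
  exists θ : α ⇒ β, fun_map (restr f F a) θ = ε.
Proof.
exists (exist _ (full_component ε) (full_component_natural ε)).
apply: CoconeHom_eq => c; exact: full_component_restr.
Qed.

Lemma restr_faithful (α β : CoconeCat F a) (θ ζ : α ⇒ β) :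
  fun_map (restr f F a) θ = fun_map (restr f F a) ζ -> θ = ζ.
Proof.
move=> e; apply: CoconeHom_eq => d.
(* The component of [ξ] at [d] is the one at the slice object [id]. Naturality carries it
   to [g d], which lies over [C], so that only the restriction of [ξ] enters there. *)
have key (ξ : CoconeHom α β) :
    fun_map (restr f F a) θ = fun_map (restr f F a) ξ -> proj1_sig ξ d ≈
      component_core (fun_map (restr f F a) θ : CoconeHom (restr_ob f α) (restr_ob f β)) d.
  move=> ->; apply: (heq_trans (heq_sym (heq_unitr (proj1_sig ξ d) (fhom_id F d)))).
  apply: heq_of_eq.
  have n := yon_natural (f := idMF D) (restr_map (idMF D) ξ).
  rewrite /component_core cmp_assoc.
  pose Y (δ : Cocone F a) := yon (f := idMF D) (restr_ob (idMF D) δ) d.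
  pose ξ_id : Y α (sob (idMF D) (id1 d)) ⇒ Y β (sob (idMF D) (id1 d)) :=
    proj1_sig ξ d ▹ fhom F (id1 d).
  have -> : fun_map (Y β) (from_g d) • slice_component (restr_map f ξ) (g d) =
      ξ_id • fun_map (Y α) (from_g d).
    exact: (eq_sym (n d _ _ (from_g d))).
  rewrite -cmp_assoc -fun_map_cmp (Initial_eq (from_g d • to_g d) (idm _) (id_initial d)).
  by rewrite fun_map_id cmp_idr.
apply: heq_eq; apply: (heq_trans (key θ (eq_refl _))); apply: heq_sym; exact: key.
Qed.

Lemma restr_equivalence : IsEquivalence (restr f F a).
Proof.
exact: (full_faithful_surj_equivalence restr_full restr_faithful restr_surjective).
Qed.

End Sufficiency.

(** * A test 2-category of categories *)

Lemma Functor_eq (K L : Category) (F G : Functor K L) :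
  (forall x, F x = G x) -> (forall (x y : K) (p : x ⇒ y), fun_map F p ≈ fun_map G p) -> F = G.
Proof.
case: F G => [Fo Fm Fi Fc] [Go Gm Gi Gc] /= /functional_extensionality e; destruct e => h.
have e : Fm = Gm.
  apply: functional_extensionality_dep => x; apply: functional_extensionality_dep => y.
  by apply: functional_extensionality => p; apply: heq_eq.
destruct e; congr Build_Functor; exact: proof_irrelevance.
Qed.

Section FunctorCategory.
Variables K L : Category.

Definition NatTrans (F G : Functor K L) : Type :=
  {η : forall x : K, F x ⇒ G x |
    forall (x y : K) (p : x ⇒ y), η y • fun_map F p = fun_map G p • η x}.

Lemma NatTrans_eq (F G : Functor K L) (η ζ : NatTrans F G) :
  (forall x, proj1_sig η x = proj1_sig ζ x) -> η = ζ.
Proof.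
case: η ζ => [η Hη] [ζ Hζ] /= h; apply: subset_eq_compat.
exact: functional_extensionality_dep.
Qed.

Program Definition FunCat : Category :=
  {| Ob := Functor K L; Hom := NatTrans;
     idm := fun F x => idm (F x);
     cmp := fun F G H ζ η x => proj1_sig ζ x • proj1_sig η x |}.
Next Obligation. by rewrite cmp_idl cmp_idr. Qed.
Next Obligation.
case: ζ η => [ζ hζ] [η hη] /=.
by rewrite -cmp_assoc hη !cmp_assoc hζ.
Qed.
Next Obligation. apply: NatTrans_eq => ?; exact: cmp_idl. Qed.
Next Obligation. apply: NatTrans_eq => ?; exact: cmp_idr. Qed.
Next Obligation. apply: NatTrans_eq => ?; exact: cmp_assoc. Qed.

Lemma NatTrans_square (F F' G G' : FunCat) (p : F = F') (q : G = G') (η : F ⇒ G)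
  (ζ : F' ⇒ G') : (forall x, proj1_sig η x ≈ proj1_sig ζ x) ->
  eqcell q • η = ζ • eqcell p.
Proof.
destruct p, q => h; rewrite cmp_idl cmp_idr; apply: NatTrans_eq => x; exact: heq_eq.
Qed.

Program Definition evalF (x : K) : Functor FunCat L :=
  {| fun_ob := fun F : Functor K L => F x; fun_map := fun F G η => proj1_sig η x |}.

Lemma NatTrans_iso (F G : FunCat) (η : F ⇒ G) :
  (forall x, is_iso (proj1_sig η x)) -> is_iso η.
Proof.
case: η => η nat /= iso.
have nat' : forall (x y : K) (p : x ⇒ y),
    iso_inv (iso y) • fun_map G p = fun_map F p • iso_inv (iso x).
  move=> x y p; apply: (iso_mono (iso y)); rewrite !cmp_assoc iso_invr cmp_idl nat.
  by rewrite -cmp_assoc iso_invr cmp_idr.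
exists (exist _ (fun x => iso_inv (iso x)) nat').
by split; apply: NatTrans_eq => x /=; rewrite ?iso_invl ?iso_invr.
Qed.

End FunctorCategory.

Section CatOn.
Variables (I : Type) (P : I -> Category).

(** Objects are the indices, and 1-morphisms [i → j] are functors [P j → P i]. *)
Definition catHom (i j : I) : Category := FunCat (P j) (P i).

Definition catComp (i j k : I) (G : catHom j k) (F : catHom i j) : catHom i k := compF F G.

Program Definition catHcomp (i j k : I) (G G' : catHom j k) (F F' : catHom i j)
  (β : G ⇒ G') (α : F ⇒ F') : catComp G F ⇒ catComp G' F' :=
  fun x => proj1_sig α (fun_ob G' x) • fun_map F (proj1_sig β x).
Next Obligation.
case: β α => [β hβ] [α hα] /=.
by rewrite -cmp_assoc -fun_map_cmp hβ fun_map_cmp !cmp_assoc hα.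
Qed.

Lemma catComp_idl (i j : I) (F : catHom i j) : catComp (idF (P j)) F = F.
Proof. by apply: Functor_eq => // x y p; apply: heq_refl. Qed.

Lemma catComp_idr (i j : I) (F : catHom i j) : catComp F (idF (P i)) = F.
Proof. by apply: Functor_eq => // x y p; apply: heq_refl. Qed.

Lemma catComp_assoc (i j k l : I) (H : catHom k l) (G : catHom j k) (F : catHom i j) :
  catComp H (catComp G F) = catComp (catComp H G) F.
Proof. by apply: Functor_eq => // x y p; apply: heq_refl. Qed.

Lemma catHcomp_idl (i j : I) (F F' : catHom i j) (α : F ⇒ F') :
  eqcell (catComp_idl F') • catHcomp (idm (idF (P j) : catHom j j)) α =
  α • eqcell (catComp_idl F).
Proof.
by apply: NatTrans_square => x /=; apply: heq_of_eq; rewrite fun_map_id cmp_idr.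
Qed.

Lemma catHcomp_idr (i j : I) (F F' : catHom i j) (α : F ⇒ F') :
  eqcell (catComp_idr F') • catHcomp α (idm (idF (P i) : catHom i i)) =
  α • eqcell (catComp_idr F).
Proof. by apply: NatTrans_square => x /=; apply: heq_of_eq; apply: cmp_idl. Qed.

Lemma catHcomp_assoc (i j k l : I) (H H' : catHom k l) (G G' : catHom j k)
  (F F' : catHom i j) (γ : H ⇒ H') (β : G ⇒ G') (α : F ⇒ F') :
  eqcell (catComp_assoc H' G' F') • catHcomp γ (catHcomp β α) =
  catHcomp (catHcomp γ β) α • eqcell (catComp_assoc H G F).
Proof.
by apply: NatTrans_square => x /=; apply: heq_of_eq; rewrite fun_map_cmp cmp_assoc.
Qed.

(** The full sub-2-category of [Cat], with reversed 1-morphisms, on a family of categories.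
    Allowing only the categories of a given family keeps the objects as small as the index
    type, so that this is a 2-category of the same size as the ones it is built from. *)
Program Definition CatOn : TwoCat :=
  {| ob := I; hom := catHom; id1 := fun i => idF (P i); comp1 := catComp;
     hcomp := catHcomp;
     comp1_idl := catComp_idl; comp1_idr := catComp_idr; comp1_assoc := catComp_assoc;
     hcomp_idl := catHcomp_idl; hcomp_idr := catHcomp_idr; hcomp_assoc := catHcomp_assoc |}.
Next Obligation. by apply: NatTrans_eq => x /=; rewrite fun_map_id cmp_idl. Qed.
Next Obligation.
apply: NatTrans_eq => x /=; rewrite fun_map_cmp !cmp_assoc; congr (_ • _).
rewrite -!cmp_assoc; congr (_ • _); exact: (proj2_sig α).
Qed.

End CatOn.

Program Definition unitCat : Category :=
  {| Ob := unit; Hom := fun _ _ => unit; idm := fun _ => tt; cmp := fun _ _ _ _ _ => tt |}.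
Next Obligation. by case: f. Qed.
Next Obligation. by case: f. Qed.

(** * The slices as a 2-functor *)

Section SliceFunctor.
Variables (C D : MarkedTwoCat) (f : MarkedFunctor C D).

Lemma heq_smap (d : D) (c c' : C) (h h' : hom d (f c)) (k k' : hom d (f c')) (u u' : hom c c')
  (β : fhom f u ∘ h ⇒ k) (β' : fhom f u' ∘ h' ⇒ k') :
  h = h' -> k = k' -> u = u' -> β ≈ β' -> smap f β ≈ smap f β'.
Proof. by move=> e e' e''; destruct e, e', e'' => /heq_eq ->; apply: heq_refl. Qed.

Lemma heq_vert (d : D) (c : C) (h h' k k' : hom d (f c)) (κ : h ⇒ h') (κ' : k ⇒ k') :
  κ ≈ κ' -> vert f κ ≈ vert f κ'.
Proof.
move=> [p [q e]]; destruct p, q; move: e; rewrite /= cmp_idl cmp_idr => ->; exact: heq_refl.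
Qed.

Lemma pull_cell_natural (b d : D) (u w : hom b d) (β : u ⇒ w) (x y : HoLoc (Slice f d))
  (p : x ⇒ y) :
  pull_cell β y • fun_map (pull f u) p = fun_map (pull f w) p • pull_cell β x.
Proof.
move: x y p; apply: (slice_natural (G := pull f u) (H := pull f w)
  (η := fun x => pull_cell β x)) => c c' h k v σ.
rewrite !pull_smap /pull_cell vert_smap smap_vert; apply: smap_ext => //.
rewrite cmp_assoc -interchange cmp_idl cmp_idr; apply: heq_eqr.
have -> : σ ⋆ β = (σ ▹ w) • ((fhom f v ∘ h) ◃ β) by rewrite -interchange cmp_idl cmp_idr.
rewrite -cmp_assoc; apply: heq_cmp; first exact: heq_refl.
by apply: heq_sym; apply: heq_eql; rewrite -hcomp_id; apply: heq_assoc.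
Qed.

Lemma pull_id_heq (d : D) (x y : HoLoc (Slice f d)) (p : x ⇒ y) :
  fun_map (pull f (id1 d)) p ≈ p.
Proof.
apply: heq_sym; exists (pull_id_ob x), (pull_id_ob y); move: x y p.
apply: (slice_natural (G := idF _) (H := pull f (id1 d))
  (η := fun x => eqcell (pull_id_ob x))) => c c' h k u β.
rewrite pull_smap; apply: heq_eq; apply: heq_eql; apply: heq_sym; apply: heq_eqr.
apply: heq_smap => //; try exact: comp1_idr.
by apply: heq_eqr; apply: heq_unitr.
Qed.

Lemma pull_comp_heq (b d e : D) (v : hom d e) (u : hom b d) (x y : HoLoc (Slice f e))
  (p : x ⇒ y) : fun_map (pull f (v ∘ u)) p ≈ fun_map (pull f u) (fun_map (pull f v) p).
Proof.
apply: heq_sym; exists (pull_comp_ob v u x), (pull_comp_ob v u y); move: x y p.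
apply: (slice_natural (G := compF (pull f u) (pull f v)) (H := pull f (v ∘ u))
  (η := fun x => eqcell (pull_comp_ob v u x))) => c c' h k w β.
rewrite !compF_map !pull_smap; apply: heq_eq; apply: heq_eql; apply: heq_sym.
apply: heq_eqr; apply: heq_smap => //; try exact: comp1_assoc.
apply: heq_eqr; apply: heq_sym; apply: heq_eqr.
rewrite whiskr_cmp eqcell_whiskr; apply: heq_eqr; rewrite -hcomp_id.
by apply: heq_sym; apply: heq_assoc.
Qed.

(** Besides the slices, the family contains the terminal category. Functors out of it are
    objects of a slice, hence a cocone under [slice2F] with vertex [None] is a cocone with
    values in the slices. *)
Definition slice_family (i : option D) : Category :=
  match i with Some d => HoLoc (Slice f d) | None => unitCat end.

Definition sliceCat : TwoCat := CatOn slice_family.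

Definition pull_trans (b d : D) (u w : hom b d) (β : u ⇒ w) : NatTrans (pull f u) (pull f w) :=
  exist _ (fun x => pull_cell β x) (@pull_cell_natural b d u w β).

Lemma pull_id_eq (d : D) : pull f (id1 d) = idF (HoLoc (Slice f d)).
Proof.
apply: Functor_eq => [x|x y p]; first exact: (eq_sym (pull_id_ob x)).
exact: pull_id_heq.
Qed.

Lemma pull_comp_eq (b d e : D) (v : hom d e) (u : hom b d) :
  pull f (v ∘ u) = compF (pull f u) (pull f v).
Proof.
apply: Functor_eq => [x|x y p]; first exact: (eq_sym (pull_comp_ob v u x)).
exact: pull_comp_heq.
Qed.

Lemma pull_trans_id (b d : D) (u : hom b d) :
  pull_trans (idm u) = idm (pull f u : FunCat _ _).
Proof. apply: NatTrans_eq => x; rewrite /= /pull_cell hcomp_id; exact: vert_id. Qed.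

Lemma pull_trans_cmp (b d : D) (u v w : hom b d) (β : v ⇒ w) (α : u ⇒ v) :
  pull_trans (β • α) = @cmp (FunCat _ _) (pull f u) (pull f v) (pull f w)
    (pull_trans β) (pull_trans α).
Proof.
apply: NatTrans_eq => x.
transitivity (pull_cell β x • pull_cell α x); last by [].
by rewrite /pull_cell vert_cmp -whiskl_cmp.
Qed.

Lemma pull_trans_hcomp (b d e : D) (v v' : hom d e) (u u' : hom b d) (β : v ⇒ v')
  (α : u ⇒ u') :
  eqcell (pull_comp_eq v' u' : (_ : FunCat _ _) = _) • pull_trans (β ⋆ α) =
  @catHcomp _ slice_family (Some b) (Some d) (Some e) (pull f v) (pull f v') (pull f u)
    (pull f u') (pull_trans β) (pull_trans α)
  • eqcell (pull_comp_eq v u : (_ : FunCat _ _) = _).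
Proof.
apply: NatTrans_square => x.
change (pull_cell (β ⋆ α) x ≈
  pull_cell α (pull f v' x) • fun_map (pull f u) (pull_cell β x)).
rewrite /pull_cell pull_vert vert_cmp -interchange cmp_idl cmp_idr.
apply: heq_vert; exact: heq_assoc.
Qed.

Definition slice2F : TwoFunctor D sliceCat :=
  @Build_TwoFunctor D sliceCat (fun d => Some d) (fun b d u => pull f u) pull_trans
    pull_trans_id pull_trans_cmp pull_id_eq pull_comp_eq pull_trans_hcomp.

End SliceFunctor.

(** * Cocones with values in the slices *)

Section UnitMaps.
Variables (C D : MarkedTwoCat) (f : MarkedFunctor C D).

Lemma unit_map_id (c : C) : unit_map f (id1 c) ≈ idm (sob f (id1 (f c))).
Proof.
rewrite -vert_id /vert; apply: heq_smap => //; first by rewrite comp1_idl fhom_id.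
by rewrite cmp_idl; apply: heq_eqcells.
Qed.

Lemma unit_map_comp (c c' c'' : C) (v : hom c' c'') (u : hom c c') :
  unit_map f (v ∘ u) ≈ fun_map (pull f (fhom f u)) (unit_map f v) • unit_map f u.
Proof.
rewrite /unit_map pull_smap smap_cmp; apply: heq_smap => //.
  by rewrite fhom_comp comp1_assoc.
rewrite eqcell_whiskr eqcell_whiskl !eqcell_cmp; exact: heq_eqcells.
Qed.

Lemma unit_map_cell (c c' : C) (u w : hom c c') (β : u ⇒ w) :
  pull_cell (fcell f β) (sob f (id1 (f c'))) • unit_map f u = unit_map f w.
Proof.
rewrite /pull_cell /unit_map vert_smap -(smap_cell (f := f) β); apply: smap_ext => //.
apply: heq_eqr; apply: (heq_trans (heq_unitl _ _)) => //; apply: heq_sym.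
apply: heq_eql; exact: heq_unitr.
Qed.

End UnitMaps.

Lemma NatTrans_heq (K L : Category) (F F' G G' : FunCat K L) (η : F ⇒ G) (ζ : F' ⇒ G') :
  F = F' -> G = G' -> (forall x, proj1_sig η x ≈ proj1_sig ζ x) -> η ≈ ζ.
Proof. by move=> p q h; exists p, q; apply: NatTrans_square. Qed.

(** The data and laws of a cocone under [slice2F f ∘ e] with vertex [None], read off at the
    unique object of the terminal category. *)
Section Sections.
Variables (C D B : MarkedTwoCat) (f : MarkedFunctor C D) (e : MarkedFunctor B D).
Variables (s : forall b : B, HoLoc (Slice f (e b)))
  (m : forall (b b' : B) (u : hom b b'), s b ⇒ pull f (fhom e u) (s b')).
Hypothesis m_marked : forall (b b' : B) (u : hom b b'), marked u -> is_iso (m u).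
Hypothesis m_id : forall b : B, m (id1 b) ≈ idm (s b).
Hypothesis m_comp : forall (b b' b'' : B) (v : hom b' b'') (u : hom b b'),
  m (v ∘ u) ≈ fun_map (pull f (fhom e u)) (m v) • m u.
Hypothesis m_cell : forall (b b' : B) (u w : hom b b') (β : u ⇒ w),
  pull_cell (fcell e β) (s b') • m u = m w.

Definition section_leg (b : B) : @hom (sliceCat f) (Some (e b)) None := constF unitCat (s b).

Program Definition section_cell (b b' : B) (u : hom b b') :
  section_leg b ⇒ section_leg b' ∘ fhom (comp2F (slice2F f) e) u := fun _ => m u.
Next Obligation.
change (m u • idm _ = fun_map (pull f (fhom e u)) (idm (s b')) • m u).
by rewrite fun_map_id cmp_idr cmp_idl.
Qed.

Lemma section_marked (b b' : B) (u : hom b b') : marked u -> is_iso (section_cell u).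
Proof. by move=> mu; apply: NatTrans_iso => x; apply: m_marked. Qed.

Lemma section_id (b : B) :
  section_cell (id1 b) = eqcell (cocone_id_eq (F := comp2F (slice2F f) e) (section_leg b)).
Proof.
have p := cocone_id_eq (F := comp2F (slice2F f) e) (section_leg b).
apply: heq_eq; apply: (heq_trans (g := idm (section_leg b))).
  by apply: (NatTrans_heq (K := unitCat) eq_refl (eq_sym p)) => x; apply: m_id.
by apply: heq_sym; apply: heq_eqcell.
Qed.

Lemma section_comp (b b' b'' : B) (v : hom b' b'') (u : hom b b') :
  section_cell (v ∘ u) = eqcell (cocone_comp_eq (F := comp2F (slice2F f) e) (section_leg b'') v u)
    • ((section_cell v ▹ fhom (comp2F (slice2F f) e) u) • section_cell u).
Proof.
have p := cocone_comp_eq (F := comp2F (slice2F f) e) (section_leg b'') v u.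
apply: heq_eq; apply: heq_sym; apply: heq_eql; apply: heq_sym.
apply: (NatTrans_heq (K := unitCat) eq_refl (eq_sym p)) => x.
change (m (v ∘ u) ≈ idm _ • fun_map (pull f (fhom e u)) (m v) • m u).
by rewrite cmp_idl; apply: m_comp.
Qed.

Lemma section_nat (b b' : B) (u w : hom b b') (β : u ⇒ w) :
  (section_leg b' ◃ fcell (comp2F (slice2F f) e) β) • section_cell u = section_cell w.
Proof.
apply: NatTrans_eq => x.
change (pull_cell (fcell e β) (s b') • fun_map (pull f (fhom e u)) (idm (s b')) • m u = m w).
by rewrite fun_map_id cmp_idr.
Qed.

Definition section_cocone : Cocone (B := B) (comp2F (slice2F f) e) None :=
  @Build_Cocone B (sliceCat f) (comp2F (slice2F f) e) None section_leg section_cell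
    section_marked section_id section_comp section_nat.

End Sections.

(** The 2-functors [F ∘ id] and [F] have the same components, but are not convertible. *)
Definition cocone_of_id (D : MarkedTwoCat) (A : TwoCat) (F : TwoFunctor D A) (a : A)
  (α : Cocone (B := D) (comp2F F (idMF D)) a) : Cocone F a.
Proof.
refine (@Build_Cocone D A F a (leg α) (fun d d' u => legcell α u) _ _ _ _).
- exact: (legcell_marked α).
- move=> d; rewrite (legcell_id α); exact: eqcell_irr.
- move=> d d' d'' v u; rewrite (legcell_comp α).
  by apply: (f_equal (fun e => e • _)); apply: eqcell_irr.
- exact: (legcell_nat α).
Defined.

Definition at_point (C D : MarkedTwoCat) (f : MarkedFunctor C D) (d : D) :
  Functor (hom (Some d : sliceCat f) None) (HoLoc (Slice f d)) :=
  @evalF unitCat (HoLoc (Slice f d)) tt.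

(** * Cofinality implies the conditions *)

Section Necessity.
Variables (C D : MarkedTwoCat) (f : MarkedFunctor C D).

(** The universal cocone on [C], with values [(c, id)]. *)
Definition unit_cocone : Cocone (B := C) (comp2F (slice2F f) f) None :=
  section_cocone (f := f) (e := f) (@unit_map_iso C D f) (@unit_map_id C D f)
    (@unit_map_comp C D f) (@unit_map_cell C D f).

Section Points.
Variable α : Cocone (slice2F f) None.

Definition point (d : D) : HoLoc (Slice f d) := at_point f d (leg α d).

Definition point_map (b d : D) (u : hom b d) : point b ⇒ pull f u (point d) :=
  fun_map (at_point f b) (legcell α u).

Lemma point_map_iso (b d : D) (u : hom b d) : marked u -> is_iso (point_map u).
Proof. move=> mu; exact: (fun_map_iso (at_point f b) (legcell_marked α mu)). Qed.

Lemma point_map_id (d : D) : point_map (id1 d) ≈ idm (point d).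
Proof. by rewrite /point_map legcell_id fun_map_eqcell; apply: heq_eqcell. Qed.

Lemma point_map_comp (b d e : D) (v : hom d e) (u : hom b d) :
  point_map (v ∘ u) ≈ fun_map (pull f u) (point_map v) • point_map u.
Proof.
rewrite /point_map legcell_comp !fun_map_cmp fun_map_eqcell; apply: heq_eql.
apply: heq_cmp; last exact: heq_refl.
change (idm _ • fun_map (pull f u) (point_map v) ≈ fun_map (pull f u) (point_map v)).
by rewrite cmp_idl; apply: heq_refl.
Qed.

Lemma point_map_cell (b d : D) (u w : hom b d) (β : u ⇒ w) :
  pull_cell β (point d) • point_map u = point_map w.
Proof.
rewrite /point_map -(legcell_nat α β) fun_map_cmp.
change (pull_cell β (point d) • point_map u =
  pull_cell β (point d) • fun_map (pull f u) (idm (point d)) • point_map u).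
by rewrite fun_map_id cmp_idr.
Qed.

Lemma push_pull_cell (b d : D) (u w : hom b d) (β : u ⇒ w) (x : HoLoc (Slice f d)) :
  fun_map (push f b) (pull_cell β x) = pull_cell (f := idMF D) β (push f d x).
Proof. exact: push_vert. Qed.

(** The image under the comparison functors of a cocone on [D] with values in the slices of
    [C]. *)
Definition push_cocone : Cocone (slice2F (idMF D)) None.
Proof.
apply: cocone_of_id.
apply: (@section_cocone D D D (idMF D) (idMF D) (fun d => push f d (point d))
  (fun b d u => fun_map (push f b) (point_map u))).
- by move=> b d u mu; exact: (fun_map_iso (push f b) (point_map_iso mu)).
- by move=> d; have := heq_fun (push f d) (point_map_id d); rewrite fun_map_id.
- move=> b d e v u; have := heq_fun (push f b) (point_map_comp v u).
  by rewrite fun_map_cmp push_pull.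
- move=> b d u w β; rewrite -(point_map_cell β) fun_map_cmp push_pull_cell.
  exact: eq_refl.
Defined.

End Points.

Lemma cocone_component_iso (B : MarkedTwoCat) (A : TwoCat) (F : TwoFunctor B A) (a : A)
  (α β : CoconeCat F a) (θ : α ⇒ β) (b : B) : is_iso θ -> is_iso (proj1_sig θ b).
Proof.
move=> [ζ [h h']]; exists (proj1_sig ζ b).
by split; [move: h | move: h'] => /(f_equal (fun ξ => proj1_sig ξ b)).
Qed.

(** Here [α] is a cocone on [D] that restricts to the universal cocone on [C], as provided by
    essential surjectivity. *)
Section UniversalExtension.
Variables (α : Cocone (slice2F f) None) (θ : CoconeHom (restr_ob f α) unit_cocone).
Hypothesis θ_iso : forall c : C, is_iso (proj1_sig θ c).

Definition unit_comparison (c : C) : point α (f c) ⇒ sob f (id1 (f c)) :=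
  fun_map (at_point f (f c)) (proj1_sig θ c).

Lemma unit_comparison_iso (c : C) : is_iso (unit_comparison c).
Proof. exact: (fun_map_iso (at_point f (f c)) (θ_iso c)). Qed.

Lemma unit_comparison_natural (c c' : C) (u : hom c c') :
  unit_map f u • unit_comparison c =
    fun_map (pull f (fhom f u)) (unit_comparison c') • point_map α (fhom f u).
Proof.
have e := f_equal (fun p => fun_map (at_point f (f c)) p) (proj2_sig θ c c' u).
transitivity (idm _ • fun_map (pull f (fhom f u)) (unit_comparison c') • point_map α (fhom f u));
  last by rewrite cmp_idl.
exact: e.
Qed.

Definition id_cocone : Cocone (slice2F (idMF D)) None :=
  cocone_of_id (section_cocone (f := idMF D) (e := idMF D) (@unit_map_iso D D (idMF D))
    (@unit_map_id D D (idMF D)) (@unit_map_comp D D (idMF D)) (@unit_map_cell D D (idMF D))).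

Program Definition push_comparison_cell (c : C) :
  leg (push_cocone α) (f c) ⇒ leg id_cocone (f c) :=
  fun _ => fun_map (push f (f c)) (unit_comparison c).
Next Obligation.
change (fun_map (push f (f c)) (unit_comparison c) • idm _ =
  idm _ • fun_map (push f (f c)) (unit_comparison c)).
by rewrite cmp_idl cmp_idr.
Qed.

Lemma push_unit_map (c c' : C) (u : hom c c') :
  fun_map (push f (f c)) (unit_map f u) = unit_map (idMF D) (fhom f u).
Proof.
rewrite /unit_map push_smap; apply: smap_ext => //; exact: heq_eqcells.
Qed.

Lemma push_comparison_natural (c c' : C) (u : hom c c') :
  legcell (restr_ob f id_cocone) u • push_comparison_cell c =
  (push_comparison_cell c' ▹ fhom (comp2F (slice2F (idMF D)) f) u)
    • legcell (restr_ob f (push_cocone α)) u.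
Proof.
apply: NatTrans_eq => x.
change (unit_map (idMF D) (fhom f u) • fun_map (push f (f c)) (unit_comparison c) =
  idm _ • fun_map (pull (idMF D) (fhom f u)) (fun_map (push f (f c')) (unit_comparison c'))
  • fun_map (push f (f c)) (point_map α (fhom f u))).
rewrite cmp_idl -push_pull -push_unit_map.
have := f_equal (fun p => fun_map (push f (f c)) p) (unit_comparison_natural u).
by rewrite !fun_map_cmp.
Qed.

Lemma push_comparison_iso : Iso (restr f (slice2F (idMF D)) None (push_cocone α))
  (restr f (slice2F (idMF D)) None id_cocone).
Proof.
exists (exist _ push_comparison_cell push_comparison_natural); apply: CoconeHom_iso => c.
apply: NatTrans_iso => x; exact: (fun_map_iso (push f (f c)) (unit_comparison_iso c)).
Qed.

(** The images of the points of [α] and the identities of [D] are the values of two cocones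
    on [D] that agree on [C]; an equivalence reflects this isomorphism. *)
Lemma push_point_initial (d : D) :
  IsEquivalence (restr f (slice2F (idMF D)) None) -> Initial (push f d (point α d)).
Proof.
move=> eqv; have [i hi] := equivalence_Iso eqv push_comparison_iso.
have iso : Iso (push f d (point α d)) (sob (idMF D) (id1 d)).
  exists (fun_map (at_point (idMF D) d) (proj1_sig i d)).
  exact: (fun_map_iso (at_point (idMF D) d) (cocone_component_iso d hi)).
exact: (Initial_Iso (id_initial d) (Iso_sym iso)).
Qed.

(** Evaluating the transformation of [α] on all of [D_{d↑}], that is
    [(e, h) ↦ h^* (point α e)]. *)
Definition retraction (d : D) : Functor (HoLoc (Slice (idMF D) d)) (HoLoc (Slice f d)) :=
  compF (at_point f d) (yon (f := idMF D) (restr_ob (idMF D) α) d).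

Lemma unit_ob (d : D) (x : HoLoc (Slice f d)) : pull f (arr x) (sob f (id1 (f (pt x)))) = x.
Proof. case: x => c h; congr (Build_SliceOb _ _ _); exact: comp1_idl. Qed.

(** The universal cocone corresponds to the identity transformation. *)
Lemma yon_unit_cocone (d : D) (x y : HoLoc (Slice f d)) (p : x ⇒ y) :
  fun_map (at_point f d) (fun_map (yon unit_cocone d) p) ≈ p.
Proof.
exists (unit_ob x), (unit_ob y); move: x y p.
apply: (slice_natural (G := compF (at_point f d) (yon unit_cocone d)) (H := idF _)
  (η := fun x => eqcell (unit_ob x))) => c c' h k u β.
apply: heq_eq; apply: heq_eql; apply: heq_sym; apply: heq_eqr; apply: heq_sym.
rewrite compF_map yonE /yon_mor !fun_map_cmp fun_map_eqcell.
set E := eqcell _.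
(* At the object of the terminal category, whiskering the universal cocone becomes the
   action of 1-cells and 2-cells of [D] on the slices. *)
change ((pull_cell β (sob f (id1 (f c'))) • fun_map (pull f (fhom f u ∘ h)) (idm _)) • E
  • (idm _ • fun_map (pull f h) (unit_map f u)) ≈ smap f β).
rewrite {}/E fun_map_id cmp_idr cmp_idl.
have -> : smap f β = vert f β • smap f (idm (fhom f u ∘ h)) by rewrite vert_smap cmp_idr.
apply: heq_cmp; first by apply: heq_eqr; apply: heq_vert; apply: heq_unitl.
rewrite pull_smap eqcell_whiskr eqcell_cmp.
apply: heq_smap => //; first exact: comp1_idl.
  by change ((id1 (f c') ∘ fhom f u) ∘ h = fhom f u ∘ h); rewrite comp1_idl.
by apply: (heq_trans (heq_eqcell _)); apply: heq_idm; rewrite /= comp1_idl.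
Qed.

(** On the image of [C_{d↑}] the transformation of [α] is that of its restriction, which is
    isomorphic to the universal cocone and thus to the identity. *)
Lemma retraction_iso (d : D) : NatIso (compF (retraction d) (push f d)) (idF _).
Proof.
exists (fun x => eqcell (unit_ob x) • fun_map (pull f (arr x)) (unit_comparison (pt x))); split.
  move=> x; apply: is_iso_cmp; first exact: eqcell_iso.
  exact: (fun_map_iso (pull f (arr x)) (unit_comparison_iso _)).
move=> x y p; change (fun_map (idF _) p) with p.
have n : fun_map (pull f (arr y)) (unit_comparison (pt y))
    • fun_map (at_point f d) (fun_map (yon (restr_ob f α) d) p) =
    fun_map (at_point f d) (fun_map (yon unit_cocone d) p)
    • fun_map (pull f (arr x)) (unit_comparison (pt x)).
  have := f_equal (fun q => fun_map (at_point f d) q) (yon_natural θ p).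
  rewrite !fun_map_cmp => n.
  rewrite -[X in X • _ = _]cmp_idl -[X in _ = _ • X]cmp_idl; exact: n.
have [q [r e]] := yon_unit_cocone p.
have {q}e : eqcell (unit_ob y) • fun_map (at_point f d) (fun_map (yon unit_cocone d) p) =
    p • eqcell (unit_ob x).
  rewrite (eqcell_irr (unit_ob y) r) e; congr (_ • _); exact: eqcell_irr.
rewrite cmp_assoc -e -!cmp_assoc; congr (_ • _); rewrite -n; congr (_ • _).
by rewrite yon_push.
Qed.

End UniversalExtension.

(** The points are those of a cocone on [D] that extends the universal cocone on [C]. *)
Lemma MarkedCofinal_points : MarkedCofinal f ->
  exists p : forall d, HoLoc (Slice f d),
    (forall d, Initial (push f d (p d))) /\
    (forall (b d : D) (w : hom b d), marked w -> Iso (p b) (pull f w (p d))) /\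
    (forall d (x : HoLoc (Slice f d)), Initial (push f d x) -> Initial x).
Proof.
move=> cof.
have [α [θ hθ]] := equivalence_surj (L := CoconeCat (comp2F (slice2F f) f) None) unit_cocone
  (cof _ (slice2F f) None).
have θ_iso c : is_iso (proj1_sig θ c) := cocone_component_iso c hθ.
exists (point α); split; [|split].
- by move=> d; apply: (push_point_initial θ_iso); apply: cof.
- by move=> b d w mw; exists (point_map α w); apply: point_map_iso.
- move=> d x; exact: (retract_reflects_initial (retraction_iso θ_iso d)).
Qed.

End Necessity.

(** * The criterion *)

(** A marked [g] is isomorphic to the identity of [d] in the localization, through the
    canonical map [id ⇒ (e, g)]. *)
Lemma marked_initial (D : MarkedTwoCat) (d e : D) (g : hom d e) :
  marked g -> Initial (sob (idMF D) g).
Proof.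
move=> mg; apply: (Initial_Iso (id_initial d)).
exists (smap (idMF D) (u := g) (k := g) (eqcell (comp1_idr g))).
by apply: (loc_mor_marked (A := Slice (idMF D) d)); split=> //; apply: eqcell_iso.
Qed.

Theorem theorem6p2p2 (C D : MarkedTwoCat) (f : MarkedFunctor C D) :
  MarkedCofinal f <->
  (forall d : D, exists (c : C) (g : hom d (f c)),
     Initial (K := HoLoc (Slice f d)) (Build_SliceOb f c g) /\
     Initial (K := HoLoc (Slice (idMF D) d)) (Build_SliceOb (idMF D) (f c) g)) /\
  (forall (d : D) (c : C) (g : hom d (f c)), marked g ->
     Initial (K := HoLoc (Slice f d)) (Build_SliceOb f c g)) /\
  (forall (b d : D) (w : hom b d), marked w ->
     PreservesInitial (HoLoc_map (precomp f w))).
Proof.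
split.
- move=> /MarkedCofinal_points [p [hp [p_marked refl_init]]]; split; [|split].
  + move=> d; exists (pt (p d)), (arr (p d)); split; last exact: hp.
    by apply: refl_init; apply: hp.
  + by move=> d c g mg; apply: refl_init; apply: marked_initial.
  + move=> b d w mw x hx; have hb := refl_init b _ (hp b).
    have hd := refl_init d _ (hp d).
    have iso_x : Iso (p d) x by exists (initial_map hd x); apply: Initial_is_iso.
    by apply: (Initial_Iso hb); apply: (Iso_trans (p_marked b d w mw)); apply: fun_Iso.
- move=> [h1 [h2 h3]] A F a.
  have h1' d : exists x : HoLoc (Slice f d), Initial x /\ Initial (push f d x).
    by have [c [g hg]] := h1 d; exists (Build_SliceOb f c g).
  pose g d := proj1_sig (constructive_indefinite_description _ (h1' d)).
  have hg d : Initial (g d) /\ Initial (push f d (g d)).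
    by rewrite /g; case: constructive_indefinite_description.
  apply: (restr_equivalence (g := g)).
  + by move=> d; case: (hg d).
  + by move=> d; case: (hg d).
  + by move=> c; apply: h2; apply: marked_id.
  + exact: h3.
Qed.
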